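(* Let $n\ge 13$ be an integer. There exists a finite sequence $p_c=p_1<p_2<\cdots<p_N$ such that the following holds for every $p\ge p_c$, where $\lambda_1<\lambda_2\le\lambda_3<0<\lambda_4$ are the eigenvalues of the associated linearized equation. For each $1\le k\le N$ one has $\lambda_2\le k\lambda_3$ if and only if $p\ge p_k$. Moreover, every positive, radial solution $\phi$ of $\Delta^2\phi=\phi^p$ in $\mathbb{R}^n$ has the following asymptotic expansion as $r=|x|\to\infty$, for suitable real constants $a_j$, $b_j$. (a) If $p_k<p<p_{k+1}$ for some $1\le k\le N$, with the convention that $p_{N+1}=\infty$, then $$r^{\frac{4}{p-1}}\phi(r)=a_0+\sum_{j=1}^{k}a_j r^{j\lambda_3}+b_1r^{\lambda_2}+a_{k+1}r^{(k+1)\lambda_3}+O\left(r^{\lambda_2+\lambda_3}\right).$$ (b) If $p=p_k$ for some $2\le k\le N$, then $k\lambda_3=\lambda_2$ and $$r^{\frac{4}{p-1}}\phi(r)=a_0+\sum_{j=1}^{k-1}a_j r^{j\lambda_3}+r^{k\lambda_3}(b_1\log r+a_k)+O\left(r^{\lambda_2+\lambda_3}\log r\right).$$ (c) If $p=p_c$, then $\lambda_2=\lambda_3$ and $$r^{\frac{4}{p-1}}\phi(r)=a_0+r^{\lambda_3}(b_1\log r+a_1)+b_2r^{2\lambda_3}(\log r)^2+O\left(r^{2\lambda_3}\log r\right).$$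
   Context: $Q_4$ is the quartic polynomial $Q_4(\alpha)=|x|^{\alpha+4}\Delta^2|x|^{-\alpha}=\alpha(\alpha+2)(\alpha+2-n)(\alpha+4-n)$. The critical power $p_c$ is defined by taking $\left(\frac{n+4}{n-4},p_c\right)$ to be the maximal interval (with left endpoint $\frac{n+4}{n-4}$) of values $p$ on which $p\,Q_4\left(\frac{4}{p-1}\right)>Q_4\left(\frac{n-4}{2}\right)$; one has $p_c<\infty$ when $n\ge 13$. The eigenvalues of the associated linearized equation are the roots $\lambda$ (counted with multiplicity) of the polynomial $\mathscr{P}(\lambda)=Q_4(m-\lambda)-p\,Q_4(m)$, where $m=\frac{4}{p-1}$. For $n\ge 13$ and $p\ge p_c$ these are all real and are labelled so that $\lambda_1<\lambda_2\le\lambda_3<0<\lambda_4$; they depend on $n$ and $p$. For a radial function, $\phi(r)$ denotes the value of $\phi(x)$ at $|x|=r$. *)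

(* Defs.v *)
From HB Require Import structures.
From mathcomp Require Export all_boot all_order all_algebra.
From mathcomp Require Export all_classical all_reals all_analysis.

Set Implicit Arguments.
Unset Strict Implicit.
Unset Printing Implicit Defensive.

Export Order.TTheory GRing.Theory Num.Theory.
Export numFieldNormedType.Exports.

Local Open Scope classical_set_scope.
Local Open Scope ring_scope.

(* Needed by the Landau notations at +oo. *)
Canonical pinfty_nbhs_filter_on (R : numFieldType) :=
  FilterType (pinfty_nbhs R) (@filter_filter R _ proper_pinfty_nbhs).

Section Q4.
Context {R : realType}.

Definition Q4 (n : nat) : {poly R} :=
  'X * ('X + 2%:P) * ('X + (2 - n%:R)%:P) * ('X + (4 - n%:R)%:P).

(* An extended real: p_c is +oo in low dimensions. *)
Definition critical_power (n : nat) : \bar R :=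
  let p0 : R := (n%:R + 4) / (n%:R - 4) in
  ereal_sup (EFin @` [set q | p0 < q /\
    forall p, p0 < p < q ->
      (Q4 n).[(n%:R - 4) / 2] < p * (Q4 n).[4 / (p - 1)]]).

Definition eigen_poly (n : nat) (p : R) : {poly R} :=
  let m := 4 / (p - 1) in
  Q4 n \Po (m%:P - 'X) - (p * (Q4 n).[m])%:P.

(* [eigen_poly] is monic of degree 4, so the factorization says that l1..l4
   are its roots, counted with multiplicity. *)
Definition ordered_eigenvalues (n : nat) (p l1 l2 l3 l4 : R) : Prop :=
  eigen_poly n p = \prod_(l <- [:: l1; l2; l3; l4]) ('X - l%:P) /\
  [/\ l1 < l2, l2 <= l3, l3 < 0 & 0 < l4].

End Q4.

Section BilaplaceEquation.
Context {R : realType} {n : nat}.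
Implicit Types (phi : 'rV[R]_n -> R) (x : 'rV[R]_n).

(* The library norm on row vectors is the sup norm. *)
Definition eucl_norm x : R := Num.sqrt (\sum_(i < n) x ord0 i ^+ 2).

Definition partial (i : 'I_n) phi : 'rV[R]_n -> R :=
  fun x => 'D_(delta_mx ord0 i) phi x.

Fixpoint Cclass (k : nat) phi : Prop :=
  continuous phi /\
  if k is k'.+1 then
    forall i : 'I_n,
      (forall x, derivable phi x (delta_mx ord0 i)) /\ Cclass k' (partial i phi)
  else True.

Definition laplacian phi : 'rV[R]_n -> R :=
  fun x => \sum_(i < n) partial i (partial i phi) x.

(* phi is a positive classical solution of Delta^2 phi = phi^p on R^n, radial
   with profile f, i.e. phi(x) = f(|x|); f is irrelevant on r < 0. *)
Definition positive_radial_solution (p : R) phi (f : R -> R) : Prop :=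
  [/\ Cclass 4 phi,
      forall x, 0 < phi x,
      forall x, phi x = f (eucl_norm x) &
      forall x, laplacian (laplacian phi) x = phi x `^ p].

End BilaplaceEquation.

(* Main.v *)
(** Put [m = 4 / (p - 1)], [a = (n - 4) / 2], [u = a - m] and
    [W (s) = e^(m s) phi (e^s)].  Then [Q4 (m - d/ds) W = W^p], where [Q4 (m - x)]
    is a quadratic polynomial in [(x + u)^2], and [Y = W - L], with
    [L^(p-1) = Q4 (m)], satisfies
    [(d/ds - l1) (d/ds - l2) (d/ds - l3) (d/ds - l4) Y = (L+Y)^p - L^p - p L^(p-1) Y],
    whose right-hand side is nonnegative by convexity.  As [W] and its derivatives are
    bounded at -oo and [l1, l2, l3 < 0], the first three factors can be inverted with
    their sign, whence [Y' >= l4 Y]; if [Y] were positive somewhere it would grow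
    exponentially and blow up in finite time, so [W <= L].  Then
    [(Q4 (m - d/ds) - Q4 (m)) W <= 0], and the same inversion gives [W' >= 0], so [W]
    increases to [L].  A Lyapunov function gives [Y = O (e^((l3 + eps) s))], and the
    expansion follows by bootstrap, inverting the four first-order factors one at a
    time on exponential polynomials modulo small errors.

    The thresholds come from [l2 <= k l3] being equivalent to the nonnegativity of a
    quartic in [u] which, divided by [u^2], is concave on [0 < u <= a], and increasing
    there as soon as it is nonpositive at [a]; hence it changes sign at most once. *)

Require Import Defs.
From mathcomp Require Import ring lra zify.

Set Implicit Arguments.
Unset Strict Implicit.
Unset Printing Implicit Defensive.

Local Open Scope classical_set_scope.
Local Open Scope ring_scope.

(** * First-order differential inequalities on the line *)

(** The spectrum is symmetric about [- u], so [l1 = l2 + l3 - l4 < l2 + l3]: the [l1] mode always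
    lies below the error term, and a logarithm can only come from [l2 = k l3], with the double root
    [l2 = l3] as the case [k = 1]. Inverting [d/ds - l] from -oo requires [l < 0], so each positive
    root needs its own argument: blow-up for the sign of [Y], boundedness of [Y] in the expansion,
    positivity of [W] for the positive root of [Q4 (m - x) - Q4 (m)]. Monotonicity of [W] also
    controls the decay. Writing [y1 = Y' - l4 Y], the signs [Y <= 0 <= Y'] give [|Y| <= y1 / l4], so
    the Lyapunov function involves only the nonnegative unknowns obtained from [Y] by applying one,
    two and three factors. The loss [eps] in its rate leaves room for the factor [s] that a double
    root produces; it is recovered later because the nonlinearity is quadratic in [Y]. *)

Definition derives {R : realType} (f df : R -> R) : Prop :=
  forall s : R, is_derive s (1 : R) f (df s).

Section Derives.
Context {R : realType}.
Implicit Types (f g df dg u v : R -> R) (l s : R).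

Lemma derives_eq f df df' : derives f df -> df =1 df' -> derives f df'.
Proof. by move=> fd e s; rewrite -e. Qed.

Lemma derivesD f g df dg : derives f df -> derives g dg ->
  derives (fun s => f s + g s) (fun s => df s + dg s).
Proof. by move=> fd gd s; exact: (is_deriveD (fd s) (gd s)). Qed.

Lemma derivesM f g df dg : derives f df -> derives g dg ->
  derives (fun s => f s * g s) (fun s => df s * g s + f s * dg s).
Proof.
move=> fd gd s; apply: (is_derive_eq (is_deriveM (fd s) (gd s))).
by rewrite /GRing.scale /=; ring.
Qed.

Lemma derives_cst (c : R) : derives (fun=> c) (fun=> 0).
Proof. by move=> s; exact: is_derive_cst. Qed.

Lemma derives_id : derives (fun s : R => s) (fun=> 1).
Proof. by move=> s; exact: is_derive_id. Qed.

Lemma derivesZ (c : R) f df : derives f df ->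
  derives (fun s => c * f s) (fun s => c * df s).
Proof.
by move=> fd; refine (derives_eq (derivesM (derives_cst c) fd) _) => s /=; ring.
Qed.

Lemma derivesB f g df dg : derives f df -> derives g dg ->
  derives (fun s => f s - g s) (fun s => df s - dg s).
Proof. by move=> fd gd s; exact: (is_deriveB (fd s) (gd s)). Qed.

Lemma derivesN f df : derives f df -> derives (fun s => - f s) (fun s => - df s).
Proof. by move=> fd s; exact: (is_deriveN (fd s)). Qed.

Lemma derives_comp f df g dg : (forall s, is_derive (g s) (1 : R) f (df (g s))) ->
  derives g dg -> derives (fun s => f (g s)) (fun s => df (g s) * dg s).
Proof. by move=> fd gd s; exact: (is_derive1_comp (fd s) (gd s)). Qed.

Lemma derives_expR (c : R) :
  derives (fun s => expR (c * s)) (fun s => c * expR (c * s)).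
Proof.
have := derives_comp (fun s => is_derive_expR (c * s)) (derivesZ c derives_id).
by move=> H; refine (derives_eq H _) => s; ring.
Qed.

Lemma derives_le f df (a b : R) : derives f df -> a <= b ->
  (forall s, a <= s <= b -> 0 <= df s) -> f a <= f b.
Proof.
move=> fd; rewrite le_eqVlt => /predU1P[->//|ab] df0.
have [||c cab] := @MVT R f df a b ab.
- by move=> x _; exact: fd.
- apply: derivable_within_continuous => x _.
  by have [] := fd x.
move=> e; rewrite -subr_ge0 e mulr_ge0//; last by rewrite subr_ge0 ltW.
by apply: df0; move: cab; rewrite in_itv /= => /andP[/ltW -> /ltW ->].
Qed.

Lemma derives_expM l u v : derives u (fun s => l * u s + v s) ->
  derives (fun s => expR (- l * s) * u s) (fun s => expR (- l * s) * v s).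
Proof.
by move=> ud; refine (derives_eq (derivesM (derives_expR (- l)) ud) _) => s /=; ring.
Qed.

(* Since [l < 0], boundedness at -oo kills the homogeneous solution, and
   [exp (- l s) u] increases from 0. *)
Lemma nonneg_from_ninfty l u v (M s0 : R) : l < 0 ->
  derives u (fun s => l * u s + v s) -> (forall s, 0 <= v s) ->
  (forall s, s <= s0 -> `|u s| <= M) -> forall s, 0 <= u s.
Proof.
move=> l0 ud v0 uM s1; rewrite leNgt; apply/negP => us1.
have Ud := derives_expM ud.
set d := - (expR (- l * s1) * u s1).
have d0 : 0 < d by rewrite oppr_gt0 pmulr_rlt0 ?expR_gt0.
have M0 : 0 <= M by exact: le_trans (normr_ge0 _) (uM s0 (lexx _)).
(* Far enough to the left that [exp (l s) >= 1 + M / d]; there [- u s >= exp (l s) d > M]. *)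
set s := Num.min (Num.min s0 s1) (M / d / l).
have ss0 : s <= s0 by rewrite /s !ge_min lexx.
have ss1 : s <= s1 by rewrite /s !ge_min lexx orbT.
have lsM : M / d <= l * s.
  have : s <= M / d / l by rewrite /s !ge_min lexx !orbT.
  by move=> /(ler_wnM2l (ltW l0)); rewrite [l * (_ / l)]mulrC divfK ?lt_eqF.
have := derives_le Ud ss1 (fun t _ => mulr_ge0 (expR_ge0 (- l * t)) (v0 t)).
rewrite -lerN2 -/d mulNr => dU.
have : expR (l * s) * d <= - u s.
  have -> : - u s = expR (l * s) * (expR (- (l * s)) * - u s).
    by rewrite mulrA -expRD subrr expR0 mul1r.
  by rewrite ler_pM2l ?expR_gt0// mulrN.
have : - u s <= M by apply: le_trans (uM s ss0); rewrite -normrN ler_norm.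
have := expR_ge1Dx (l * s) => e1 e2 e3.
have : (1 + M / d) * d <= M.
  apply: le_trans (le_trans e3 e2); rewrite ler_pM2r//.
  by apply: le_trans e1; rewrite lerD2l.
by rewrite mulrDl mul1r divfK ?gt_eqF//; lra.
Qed.

(** [exp (- l t) u] has slope at least [exp (- l s - |l|) H] on the step, and undoing the factor
    costs another [exp (- |l|)]. Steps of length at most 1 make the loss depend on [l] only. *)
Lemma growth_step l u v (H s d : R) : derives u (fun s => l * u s + v s) ->
  0 <= H -> 0 <= d <= 1 -> (forall t, s <= t <= s + d -> H <= v t) ->
  0 <= u s -> expR (- 2 * `|l|) * d * H <= u (s + d).
Proof.
move=> ud H0 /andP[d0 d1] vH us0.
set k := expR (- l * s - `|l|) * H.
have Ud := derivesB (derives_expM ud) (derivesZ k derives_id).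
have le1 : s <= s + d by rewrite lerDl.
have := derives_le Ud le1 => /(_ _)/wrap[] /=.
  move=> t /andP[st ts]; rewrite subr_ge0 mulr1.
  apply: (@le_trans _ _ (expR (- l * t) * H)).
    rewrite /k ler_wpM2r// ler_expR.
    have -> : - l * t = - l * s - l * (t - s) by ring.
    rewrite lerD2l lerN2 (le_trans (ler_norm _))// normrM.
    by rewrite ler_piMr// ger0_norm; lra.
  by rewrite ler_wpM2l ?expR_ge0// vH// st ts.
move=> e.
have {}e : k * d <= expR (- l * (s + d)) * u (s + d).
  have : 0 <= expR (- l * s) * u s by rewrite mulr_ge0 ?expR_ge0.
  by move: e; rewrite mulrDr; lra.
have : expR (l * (s + d)) * (k * d) <= u (s + d).
  have -> : u (s + d) = expR (l * (s + d)) * (expR (- l * (s + d)) * u (s + d)).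
    by rewrite mulrA -expRD mulNr subrr expR0 mul1r.
  by rewrite ler_pM2l ?expR_gt0.
apply: le_trans.
have -> : expR (l * (s + d)) * (k * d) = expR (l * d - `|l|) * (d * H).
  rewrite /k; transitivity (expR (l * (s + d)) * expR (- l * s - `|l|) * (d * H)).
    by ring.
  by rewrite -expRD; congr (expR _ * _); ring.
rewrite -mulrA ler_wpM2r ?mulr_ge0// ler_expR.
have : - `|l| <= l * d.
  rewrite lerNl (le_trans (ler_norm _))// normrN normrM.
  by rewrite ler_piMr// ger0_norm.
lra.
Qed.

Lemma derives_nonincr f df (a b : R) : derives f df -> a <= b ->
  (forall s, a <= s <= b -> df s <= 0) -> f b <= f a.
Proof.
move=> fd ab df0; have := derives_le (derivesZ (-1) fd) ab.
move=> /(_ _)/wrap[] => [s sab|]; last by rewrite !mulN1r lerN2.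
by rewrite mulN1r oppr_ge0 df0.
Qed.

End Derives.

(** * Chains of first-order equations *)

Lemma expr_unbounded {R : realType} (B A : R) : 1 < B -> exists j : nat, A < B ^+ j.
Proof.
move=> B1; pose j := Num.bound `|A / (B - 1)|.
have B10 : 0 < B - 1 by rewrite subr_gt0.
exists j.
have : 1 + j%:R * (B - 1) <= B ^+ j.
  elim: j => [|j IH]; first by rewrite mul0r addr0 expr0.
  rewrite exprS -natr1 mulrDl mul1r.
  have : B * (1 + j%:R * (B - 1)) <= B * B ^+ j by rewrite ler_pM2l; lra.
  have : 0 <= j%:R * (B - 1) ^+ 2 by rewrite mulr_ge0// exprn_ge0// ltW.
  nra.
have : A / (B - 1) < j%:R by apply: le_lt_trans (ler_norm _) (archi_boundP _).
by rewrite ltr_pdivrMr//; lra.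
Qed.

Section Chain.
Context {R : realType}.
Implicit Types (y h : R -> R) (l s : R).

(** The integrating factor first shows that [y0] stays above [y0 s], hence its slope stays above
    [l * y0 s]. Linear growth is enough to get monotonicity and to reach any given level. *)
Lemma growth_above l y0 y1 s : 0 < l -> derives y0 (fun s => l * y0 s + y1 s) ->
  (forall s, 0 <= y1 s) -> 0 < y0 s -> forall t, s <= t -> y0 s + (l * y0 s) * (t - s) <= y0 t.
Proof.
move=> l0 yd y10 ys t st.
have pos r : s <= r -> y0 s <= y0 r.
  move=> sr; have := derives_le (derives_expM yd) sr.
  move=> /(_ _)/wrap[] => [x _|]; first by rewrite mulr_ge0 ?expR_ge0.
  move=> e; have : expR (l * r) * (expR (- l * s) * y0 s) <= y0 r.
    have -> : y0 r = expR (l * r) * (expR (- l * r) * y0 r).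
      by rewrite mulrA -expRD mulNr subrr expR0 mul1r.
    by rewrite ler_pM2l ?expR_gt0.
  apply: le_trans; rewrite mulrA -expRD ler_peMl//; first exact: ltW.
  rewrite -[leLHS]expR0 ler_expR.
  by rewrite mulNr -mulrBr mulr_ge0 ?subr_ge0// ltW.
have := derives_le (derivesB yd (derivesZ (l * y0 s) derives_id)) st.
move=> /(_ _)/wrap[] => [x /andP[sx _]|]; last by rewrite mulrBr; lra.
rewrite mulr1; have : l * y0 s <= l * y0 x by rewrite ler_pM2l// pos.
by have := y10 x; lra.
Qed.

(* With steps of length [4 * 2^-j] the values of [y0] satisfy [Y_(j+1) >= c 16^-j Y_j ^ p],
   hence outgrow a geometric sequence within bounded time. *)
Lemma blow_up (l1 l2 l3 l4 p kap ys : R) y0 y1 y2 y3 h :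
  0 < l4 -> 1 < p -> 0 < kap ->
  derives y0 (fun s => l4 * y0 s + y1 s) -> derives y1 (fun s => l3 * y1 s + y2 s) ->
  derives y2 (fun s => l2 * y2 s + y3 s) -> derives y3 (fun s => l1 * y3 s + h s) ->
  (forall s, 0 <= y1 s) -> (forall s, 0 <= y2 s) -> (forall s, 0 <= y3 s) ->
  (forall s, ys <= y0 s -> kap * y0 s `^ p <= h s) -> forall s, y0 s <= 0.
Proof.
move=> l40 p1 kap0 d0 d1 d2 d3 y10 y20 y30 hy s0; rewrite leNgt; apply/negP => ys0.
pose E l := expR (- 2 * `|l|) : R.
pose C := E l1 * E l2 * E l3 * E l4 * kap.
have E0 l : 0 < E l by exact: expR_gt0.
have Ege l : 0 <= E l by exact: ltW.
have C0 : 0 < C by rewrite /C !mulr_gt0.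
have mono s t : s0 <= s -> s <= t -> y0 s <= y0 t /\ 0 < y0 s.
  move=> ss0 st; have ys1 : 0 < y0 s.
    apply: (lt_le_trans ys0); apply: le_trans (growth_above l40 d0 y10 ys0 ss0).
    by rewrite lerDl; apply: mulr_ge0; [apply: mulr_ge0; exact: ltW|rewrite subr_ge0].
  split=> //; apply: le_trans (growth_above l40 d0 y10 ys1 st).
  by rewrite lerDl; apply: mulr_ge0; [apply: mulr_ge0; exact: ltW|rewrite subr_ge0].
(* One [growth_step] per factor, each of length [d]: hence [d ^ 4], while [C] collects the four
   exponential losses and [kap]. *)
have step s d : s0 <= s -> ys <= y0 s -> 0 <= d <= 1 ->
    C * d ^+ 4 * y0 s `^ p <= y0 (s + d + d + d + d).
  move=> ss0 ysy d01; have /andP[dp d1'] := d01.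
  have mon t : s <= t -> kap * y0 s `^ p <= h t.
    move=> st; have [m1 m2] := mono _ _ ss0 st.
    apply: le_trans (hy t (le_trans ysy m1)); rewrite ler_pM2l//.
    by rewrite ge0_ler_powR// ?nnegrE; lra.
  have [_ ysp] := mono _ _ ss0 (lexx s).
  have [H HE] : exists H, H = kap * y0 s `^ p by exists (kap * y0 s `^ p).
  have H0 : 0 <= H by rewrite HE mulr_ge0 ?powR_ge0 ?ltW.
  rewrite -HE in mon.
  have a3 t : s + d <= t -> E l1 * d * H <= y3 t.
    move=> st; have -> : t = t - d + d by ring.
    apply: (growth_step d3) => // [r /andP[r1 r2]]; apply: mon; lra.
  have a2 t : s + d + d <= t -> E l2 * d * (E l1 * d * H) <= y2 t.
    move=> st; have -> : t = t - d + d by ring.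
    apply: (growth_step d2) => // [|r /andP[r1 r2]]; last by apply: a3; lra.
    by rewrite !mulr_ge0.
  have a1 t : s + d + d + d <= t -> E l3 * d * (E l2 * d * (E l1 * d * H)) <= y1 t.
    move=> st; have -> : t = t - d + d by ring.
    apply: (growth_step d1) => // [|r /andP[r1 r2]]; last by apply: a2; lra.
    by rewrite !mulr_ge0.
  have -> : C * d ^+ 4 * y0 s `^ p =
      E l4 * d * (E l3 * d * (E l2 * d * (E l1 * d * H))) by rewrite /C HE; ring.
  apply: (growth_step d0) => // [|r /andP[r1 r2]|]; last first.
  - by have [_ /ltW] := mono (s + d + d + d) (s + d + d + d) ltac:(lra) (lexx _).
  - by apply: a1; lra.
  by rewrite !mulr_ge0.
have p10 : 0 < p - 1 by lra.
(* [B ^ (p - 1) = 16] pays for the factor [d ^ 4 = 16 ^ (- j)] lost at stage [j]. *)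
pose B := (16 : R) `^ (p - 1)^-1.
have B1 : 1 < B.
  have -> : (1 : R) = 1 `^ (p - 1)^-1 by rewrite powR1.
  by rewrite /B gt0_ltr_powR ?nnegrE ?invr_gt0//; lra.
have Bp : B `^ (p - 1) = 16 by rewrite /B -powRrM mulVf ?gt_eqF// powRr1.
(* [M] exceeds 1 and [ys], and makes [C * M ^ (p - 1) >= B], so that each stage multiplies the lower
   bound by [B]. *)
pose M := 1 + `|ys| + (B / C) `^ (p - 1)^-1.
have BC0 : 0 < B / C by rewrite divr_gt0// (lt_trans ltr01).
have M1 : 1 <= M.
  by rewrite /M -addrA lerDl addr_ge0// powR_ge0.
have MC : B <= C * M `^ (p - 1).
  rewrite mulrC -ler_pdivrMr//.
  have -> : B / C = ((B / C) `^ (p - 1)^-1) `^ (p - 1).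
    by rewrite -powRrM mulVf ?gt_eqF// powRr1// ltW.
  rewrite ge0_ler_powR ?nnegrE ?powR_ge0//; [lra|lra|].
  by rewrite /M lerDr addr_ge0.
pose s1 := s0 + M / (l4 * y0 s0).
have ly : 0 < l4 * y0 s0 by rewrite mulr_gt0.
have s01 : s0 <= s1 by rewrite /s1 lerDl divr_ge0; lra.
have ys1 : M <= y0 s1.
  apply: le_trans (growth_above l40 d0 y10 ys0 s01).
  by rewrite /s1 addrAC subrr add0r mulrC divfK ?gt_eqF// lerDr ltW.
(* Partial sums of the lengths [4 * 2^-j]: all these times stay below [s1 + 8], where [y0] would
   have to be infinite. *)
pose sj j := s1 + 8 - 8 * (2 ^-1) ^+ j : R.
have q0 j : 0 <= (2^-1 : R) ^+ j <= 1.
  by rewrite exprn_ge0//= exprn_ile1//; lra.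
have sj1 j : s1 <= sj j by rewrite /sj; have := q0 j; lra.
have yj j : M * B ^+ j <= y0 (sj j).
  elim: j => [|j IH]; first by rewrite /sj !expr0 !mulr1 addrK.
  have -> : sj j.+1 = sj j + 2^-1 ^+ j + 2^-1 ^+ j + 2^-1 ^+ j + 2^-1 ^+ j.
    by rewrite /sj exprS; lra.
  have Bj : 1 <= B ^+ j by rewrite exprn_ege1// ltW.
  have yM : M <= M * B ^+ j by rewrite ler_peMr; lra.
  apply: le_trans (step _ _ _ _ _); last exact: q0.
  - apply: (@le_trans _ _ (C * 2^-1 ^+ j ^+ 4 * (M * B ^+ j) `^ p)); last first.
      rewrite ler_pM2l ?ge0_ler_powR ?nnegrE; [by []|lra|lra|lra| exact: IH|].
      by rewrite mulr_gt0 ?exprn_gt0//; lra.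
    have MB0 : 0 < M * B ^+ j by lra.
    have -> : (M * B ^+ j) `^ p = M * B ^+ j * (M `^ (p - 1) * 16 ^+ j).
      rewrite [in LHS](_ : p = 1 + (p - 1)); last by ring.
      rewrite (@powRD _ _ 1 (p - 1)); last by apply/implyP => _; rewrite gt_eqF.
      rewrite powRr1 ?ltW//; congr (_ * _); rewrite powRM; [|lra|lra].
      by rewrite -[B ^+ j]powR_mulrn; [rewrite -powRrM [_%:R * _]mulrC powRrM Bp powR_mulrn//|lra].
    have -> : C * 2^-1 ^+ j ^+ 4 * (M * B ^+ j * (M `^ (p - 1) * 16 ^+ j)) =
       M * B ^+ j * (C * M `^ (p - 1)).
      have : (2^-1 ^+ j ^+ 4 * 16 ^+ j : R) = 1.
        rewrite -exprM mulnC exprM -exprMn.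
        have -> : (2^-1 ^+ 4 * 16 : R) = 1 by field.
        by rewrite expr1n.
      move: (2^-1 ^+ j) (16 ^+ j) (M `^ (p - 1)) (B ^+ j) => x z m bj e.
      by rewrite -[RHS]mulr1 -e; ring.
    by rewrite exprSr mulrA ler_pM2l.
  - exact: le_trans s01 (sj1 j).
  - apply: le_trans IH; apply: le_trans yM; rewrite /M.
    have := ler_norm ys; have := powR_ge0 (B / C) (p - 1)^-1; lra.
have [j Bj] := expr_unbounded (y0 (s1 + 8)) B1.
have : y0 (sj j) <= y0 (s1 + 8).
  have [||//] := mono (sj j) (s1 + 8); first exact: le_trans s01 (sj1 j).
  by rewrite /sj; have := q0 j; lra.
have := yj j; have Bj1 : 1 <= B ^+ j by rewrite exprn_ege1// ltW.
have : B ^+ j <= M * B ^+ j by rewrite ler_peMl; lra.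
lra.
Qed.

End Chain.

(** * Monotonicity, convergence and decay along a chain *)

Section Chain2.
Context {R : realType}.
Implicit Types (l s : R).

(** For a positive root [mu], positivity of [w] replaces inversion from -oo: once [w1] is negative
    it can only decrease, so [w] stays below a falling line and reaches 0. *)
Lemma derives_nonneg_of_pos (mu : R) (w w1 z : R -> R) : 0 < mu ->
  derives w w1 -> derives w1 (fun s => mu * w1 s + z s) ->
  (forall s, z s <= 0) -> (forall s, 0 < w s) -> forall s, 0 <= w1 s.
Proof.
move=> mu0 wd w1d z0 wpos s0; rewrite leNgt; apply/negP => w1s.
have dm : derives (fun s => - w1 s) (fun s => mu * - w1 s + - z s).
  by refine (derives_eq (derivesN w1d) _) => s; ring.
have ns s : 0 <= - z s by rewrite oppr_ge0.
have d0 : 0 < - w1 s0 by rewrite oppr_gt0.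
have g := growth_above mu0 dm ns d0.
have wle s : s0 <= s -> w s <= w s0 + w1 s0 * (s - s0).
  move=> ss; have := derives_nonincr (derivesB wd (derivesZ (w1 s0) derives_id)) ss.
  move=> /(_ _)/wrap[t /andP[st _]|]; last by rewrite mulrBr; lra.
  have := g t st; have : 0 <= mu * - w1 s0 * (t - s0).
    by rewrite mulr_ge0 ?subr_ge0// mulr_ge0 ?ltW.
  by lra.
have ss : s0 <= s0 + w s0 / - w1 s0 by rewrite lerDl divr_ge0 ?ltW.
have := wle _ ss; have -> : w s0 + w1 s0 * (s0 + w s0 / - w1 s0 - s0) = 0.
  by field; rewrite lt_eqF.
by rewrite leNgt wpos.
Qed.

Lemma growth_nonpos (l : R) (u v : R -> R) (H s : R) :
  derives u (fun s => l * u s + v s) ->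
  0 <= H -> (forall t, s <= t -> v t <= - H) -> (forall t, u t <= 0) ->
  forall t, s + 1 <= t -> u t <= - (expR (- 2 * `|l|) * H).
Proof.
move=> ud H0 vH u0 t st.
have ud' : derives (fun s => - u s) (fun s => l * - u s + - v s).
  by refine (derives_eq (derivesN ud) _) => r; ring.
have := @growth_step R l _ _ H (t - 1) 1 ud' H0; rewrite ler01 lexx subrK mulr1.
move=> /(_ isT)/(_ _)/wrap[r /andP[r1 _]|]; first by rewrite lerNr vH//; lra.
by move=> /(_ _)/wrap[]; [rewrite oppr_ge0|lra].
Qed.

(** A forcing below [- c] pushes [z3], then [z2], below a fixed negative level after unit delays.
    Since [z2] is the derivative of [w1 - mu4 * w], this quantity tends to -oo, although [w1 >= 0]
    and [w <= L] bound it from below. *)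
Lemma no_uniform_drift (mu1 mu2 mu4 L c s0 : R) (w w1 z2 z3 F : R -> R) : 0 < mu4 ->
  derives w w1 -> derives w1 (fun s => mu4 * w1 s + z2 s) ->
  derives z2 (fun s => mu2 * z2 s + z3 s) -> derives z3 (fun s => mu1 * z3 s + F s) ->
  (forall s, w s <= L) -> (forall s, 0 <= w1 s) ->
  (forall s, z2 s <= 0) -> (forall s, z3 s <= 0) -> 0 < c ->
  (forall s, s0 <= s -> F s <= - c) -> False.
Proof.
move=> mu0 wd w1d z2d z3d wL w10 z20 z30 c0 Fc.
have h3 := growth_nonpos z3d (ltW c0) Fc z30.
set c3 := expR (-2 * `|mu1|) * c in h3.
have c30 : 0 < c3 by rewrite mulr_gt0// expR_gt0.
have h2 := growth_nonpos z2d (ltW c30) h3 z20.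
set c2 := expR (-2 * `|mu2|) * c3 in h2.
have c20 : 0 < c2 by rewrite mulr_gt0// expR_gt0.
set s2 := s0 + 1 + 1 in h2.
pose A := w1 s2 + mu4 * L - mu4 * w s2 + 1.
have A0 : 0 < A.
  have := w10 s2; have : mu4 * w s2 <= mu4 * L by rewrite ler_pM2l.
  by rewrite /A; lra.
have ss : s2 <= s2 + A / c2 by rewrite lerDl divr_ge0 ?ltW.
have dd := derivesD (derivesB w1d (derivesZ mu4 wd)) (derivesZ c2 derives_id).
have := derives_nonincr dd ss => /(_ _)/wrap[t /andP[st _]|].
  by have := h2 t st; lra.
have -> : c2 * (s2 + A / c2) = c2 * s2 + A by field; rewrite gt_eqF.
have := w10 (s2 + A / c2); have : mu4 * w (s2 + A / c2) <= mu4 * L by rewrite ler_pM2l.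
by rewrite /A; lra.
Qed.

(* The weights of the Lyapunov function [y1 + al * y2 + be * y3] make its
   derivative at most [l3 + d] times itself. *)
Lemma chain_decay (l1 l2 l3 d : R) (y1 y2 y3 h : R -> R) :
  l1 < l3 -> l2 <= l3 -> 0 < d ->
  derives y1 (fun s => l3 * y1 s + y2 s) ->
  derives y2 (fun s => l2 * y2 s + y3 s) -> derives y3 (fun s => l1 * y3 s + h s) ->
  (forall s, 0 <= y1 s) -> (forall s, 0 <= y2 s) -> (forall s, 0 <= y3 s) ->
  (forall e, 0 < e -> exists s0, forall s, s0 <= s -> h s <= e * y1 s) ->
  exists C s0, forall s, s0 <= s -> y1 s <= C * expR ((l3 + d) * s).
Proof.
move=> l13 l23 d0 d1 d2 d3 y10 y20 y30 hs.
(* These weights cancel the coefficients of [y2] and [y3] in [V' - (l3 + d) V], which leaves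
   [be * h - d * y1]. *)
pose al := (d + l3 - l2)^-1; pose be := al / (d + l3 - l1).
have al0 : 0 < al by rewrite invr_gt0; lra.
have be0 : 0 < be by rewrite divr_gt0//; lra.
have [s0 hs0] := hs (d / be) (divr_gt0 d0 be0).
pose V s := y1 s + (al * y2 s + be * y3 s).
have Vd := derivesD d1 (derivesD (derivesZ al d2) (derivesZ be d3)).
have Ud := derivesM (derives_expR (- (l3 + d))) Vd.
exists (expR (- (l3 + d) * s0) * V s0), s0 => s ss.
have := derives_nonincr Ud ss => /(_ _)/wrap[t /andP[st _]|e].
  have -> : forall x y z w : R, x * y * z + y * w = y * (x * z + w) by move=> *; ring.
  rewrite pmulr_rle0 ?expR_gt0//.
  have a1 : al * (d + l3 - l2) = 1 by rewrite /al mulVf// gt_eqF//; lra.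
  have b1 : be * (d + l3 - l1) = al by rewrite /be divfK// gt_eqF//; lra.
  have : be * h t <= d * y1 t.
    by rewrite mulrC -ler_pdivlMr// mulrAC hs0.
  have e1 : (al * (d + l3 - l2)) * y2 t = y2 t by rewrite a1 mul1r.
  have e2 : (be * (d + l3 - l1)) * y3 t = al * y3 t by rewrite b1.
  nra.
have : expR ((l3 + d) * s) * (expR (- (l3 + d) * s) * V s) <=
       expR ((l3 + d) * s) * (expR (- (l3 + d) * s0) * V s0).
  by rewrite ler_pM2l ?expR_gt0.
rewrite mulrA -expRD mulNr subrr expR0 mul1r mulrC; apply: le_trans.
by rewrite /V lerDl addr_ge0// mulr_ge0// ltW.
Qed.

End Chain2.

(** * Exponential polynomials and error terms *)

Definition ep {R : realType} (k : nat) (mu : R) : R -> R :=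
  fun s => s ^+ k * expR (mu * s).

(** The condition [1 <= s0] makes [ep q be] nondecreasing in the degree [q] on the range
    considered. *)
Definition bO {R : realType} (v : R -> R) (q : nat) (be : R) : Prop :=
  exists C s0 : R, [/\ 0 <= C, 1 <= s0 &
    forall s, s0 <= s -> `|v s| <= C * ep q be s].

(** The lexicographic order, exponent before degree, under which [ep k mu] is [O (ep q be)]. *)
Definition negl {R : realType} (k : nat) (mu : R) (q : nat) (be : R) : Prop :=
  mu < be \/ mu = be /\ (k <= q)%N.

Section BigO.
Context {R : realType}.
Implicit Types (u v : R -> R) (l mu be s : R) (k q : nat).

Lemma ep_ge0 k mu s : 0 <= s -> 0 <= ep k mu s.
Proof. by move=> s0; rewrite mulr_ge0 ?expR_ge0 ?exprn_ge0. Qed.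

Lemma epD k mu k' mu' s : ep k mu s * ep k' mu' s = ep (k + k') (mu + mu') s.
Proof. by rewrite /ep mulrACA -exprD -expRD -mulrDl. Qed.

Lemma derives_ep k mu :
  derives (ep k mu) (fun s => k%:R * s ^+ k.-1 * expR (mu * s) + mu * ep k mu s).
Proof.
elim: k => [|k IH].
  refine (derives_eq (f := ep 0 mu) _ _).
    have -> : ep 0 mu = fun s => expR (mu * s).
      by apply/funext => s; rewrite /ep mul1r.
    exact: derives_expR.
  by move=> s; rewrite /ep expr0 /=; ring.
have -> : ep k.+1 mu = fun s => s * ep k mu s.
  by apply/funext => s; rewrite /ep exprS mulrA.
refine (derives_eq (derivesM derives_id IH) _) => s /=.
rewrite /ep; case: k {IH} => [|k] /=; first by rewrite !expr0; ring.
by rewrite -natr1 exprS; ring.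
Qed.

Lemma bO_ep k mu : bO (ep k mu) k mu.
Proof.
exists 1, 1; split => // s s1; rewrite mul1r ger0_norm//.
by apply: ep_ge0; lra.
Qed.

Lemma bO_eq u v q be : u =1 v -> bO u q be -> bO v q be.
Proof. by move=> /funext ->. Qed.

Lemma bOD u v q be : bO u q be -> bO v q be -> bO (fun s => u s + v s) q be.
Proof.
move=> [C [s0 [C0 s01 uC]]] [D [t0 [D0 t01 vD]]].
exists (C + D), (Num.max s0 t0); split; [lra|by rewrite le_max s01|move=> s].
rewrite ge_max => /andP[/uC h1 /vD h2].
by rewrite mulrDl (le_trans (ler_normD _ _))// lerD.
Qed.

Lemma bOM u v q be q' be' : bO u q be -> bO v q' be' ->
  bO (fun s => u s * v s) (q + q') (be + be').
Proof.
move=> [C [s0 [C0 s01 uC]]] [D [t0 [D0 t01 vD]]].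
exists (C * D), (Num.max s0 t0); split; [exact: mulr_ge0|by rewrite le_max s01|].
move=> s; rewrite ge_max => /andP[/uC h1 /vD h2].
by rewrite normrM -epD mulrACA ler_pM.
Qed.

Lemma bOZ (c : R) v q be : bO v q be -> bO (fun s => c * v s) q be.
Proof.
move=> [C [s0 [C0 s01 uC]]]; exists (`|c| * C), s0; split => //.
  by rewrite mulr_ge0.
by move=> s /uC h; rewrite normrM -mulrA ler_wpM2l.
Qed.

Lemma expr_le_expR k (eta : R) : 0 < eta ->
  exists2 C : R, 0 <= C & forall s, 0 <= s -> s ^+ k <= C * expR (eta * s).
Proof.
move=> e0; case: k => [|k].
  exists 1 => // s s0; rewrite expr0 mul1r -[leLHS]expR0 ler_expR.
  by rewrite mulr_ge0// ltW.
have f0 : (0 : R) < (k.+1)`!%:R by rewrite ltr0n fact_gt0.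
have c0 : 0 < (k.+1)`!%:R / eta ^+ k.+1 by rewrite divr_gt0// exprn_gt0.
exists ((k.+1)`!%:R / eta ^+ k.+1) => [|s s0]; first exact: ltW.
have := @expR_ge1Dxn R (eta * s) k; rewrite mulr_ge0 ?(ltW e0)// => /(_ isT).
move=> h1; have h : (eta * s) ^+ k.+1 / (k.+1)`!%:R <= expR (eta * s) by lra.
apply: le_trans (ler_wpM2l (ltW c0) h); rewrite exprMn.
by rewrite le_eqVlt; apply/orP; left; apply/eqP; field; rewrite !gt_eqF ?exprn_gt0.
Qed.

Lemma bO_weaken v k mu q be : negl k mu q be -> bO v k mu -> bO v q be.
Proof.
move=> ng [C [s0 [C0 s01 vC]]].
have [D D0 hD] : exists2 D : R, 0 <= D & forall s, 1 <= s -> ep k mu s <= D * ep q be s.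
  case: ng => [mb|[-> kq]].
    have [D D0 hD] : exists2 D : R, 0 <= D & forall s, 0 <= s -> s ^+ k <= D * expR ((be - mu) * s).
      by apply: expr_le_expR; rewrite subr_gt0.
    exists D => // s s1; have := hD s; rewrite /ep => /(_ _)/wrap[|h]; first lra.
    apply: (@le_trans _ _ (D * expR (be * s))).
      apply: le_trans (ler_wpM2r (expR_ge0 _) h) _.
      by rewrite -mulrA -expRD; rewrite mulrBl subrK.
    by rewrite ler_wpM2l// ler_peMl ?expR_ge0// exprn_ege1.
  exists 1 => // s s1; rewrite mul1r ler_wpM2r ?expR_ge0//.
  by rewrite ler_weXn2l.
exists (C * D), s0; split => //; first exact: mulr_ge0.
move=> s ss; apply: le_trans (vC _ ss) _; rewrite -mulrA ler_wpM2l//.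
by apply: hD; lra.
Qed.

(* [exp (- l s) u] is squeezed between monotone functions whose gap is
   [O (ep q (be - l))]; no integral is needed. *)
Lemma bO_solve l u v q be : l != be -> derives u (fun s => l * u s + v s) ->
  bO v q be -> exists c, bO (fun s => u s - c * ep 0 l s) q be.
Proof.
move=> lb ud [C [s0 [C0 s01 vC]]].
pose g := be - l.
have g0 : 0 < `|g| by rewrite normr_gt0 subr_eq0 eq_sym.
have Ud := derives_expM ud.
have epg s : expR (- l * s) * ep q be s = ep q g s.
  by rewrite /ep mulrCA -expRD; congr (_ * expR _); rewrite /g; ring.
have ev s : s0 <= s -> `|expR (- l * s) * v s| <= C * ep q g s.
  move=> ss; rewrite normrM ger0_norm ?expR_ge0// -epg mulrCA.
  by rewrite ler_wpM2l ?expR_ge0// vC.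
have uU s : u s = expR (l * s) * (expR (- l * s) * u s).
  by rewrite mulrA -expRD mulNr subrr expR0 mul1r.
have epb s : expR (l * s) * ep q g s = ep q be s.
  by rewrite -epg mulrA -expRD mulNr subrr expR0 mul1r.
(* If [l < be] the homogeneous mode is absorbed by the error and the constant is 0; otherwise the
   constant is the limit of [exp (- l s) u]. *)
have [gp|gn] := ltP 0 g.
  exists 0; pose K := C / g.
  have K0 : 0 <= K by rewrite divr_ge0// ltW.
  have Kd s : s0 <= s ->
     C * ep q g s <= K * (q%:R * s ^+ q.-1 * expR (g * s) + g * ep q g s).
    move=> ss; rewrite mulrDr [K * (g * _)]mulrA /K divfK ?gt_eqF// lerDr.
    by rewrite !mulr_ge0 ?expR_ge0 ?exprn_ge0 ?invr_ge0//; lra.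
  exists (`|expR (- l * s0) * u s0| + K), s0; split => //; first exact: addr_ge0.
  move=> s ss; have e1 : 1 <= ep q g s.
    have s1 : 1 <= s by lra.
    rewrite /ep -[leLHS]mul1r ler_pM ?exprn_ege1//.
    by rewrite -[leLHS]expR0 ler_expR mulr_ge0; lra.
  have := derives_le (derivesB (derivesZ K (derives_ep q g)) Ud) ss.
  move=> /(_ _)/wrap[t /andP[t0 _]|h1].
    rewrite subr_ge0; apply: le_trans (Kd _ t0); apply: le_trans (ev _ t0).
    exact: ler_norm.
  have := derives_le (derivesD (derivesZ K (derives_ep q g)) Ud) ss.
  move=> /(_ _)/wrap[t /andP[t0 _]|h2].
    rewrite -lerBlDr sub0r; apply: le_trans (Kd _ t0); apply: le_trans (ev _ t0).
    by rewrite -normrN ler_norm.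
  have Ks0 : 0 <= K * ep q g s0 by rewrite mulr_ge0// ep_ge0//; lra.
  have : `|expR (- l * s) * u s| <= (`|expR (- l * s0) * u s0| + K) * ep q g s.
    have := ler_norm (expR (- l * s0) * u s0).
    have := ler_norm (- (expR (- l * s0) * u s0)); rewrite normrN.
    have : `|expR (- l * s0) * u s0| <= `|expR (- l * s0) * u s0| * ep q g s.
      by rewrite ler_peMr.
    by move=> *; rewrite ler_norml mulrDl; apply/andP; split; lra.
  move=> h; rewrite mul0r subr0 uU normrM ger0_norm ?expR_ge0//.
  by rewrite -epb [leRHS]mulrCA ler_wpM2l ?expR_ge0.
have {}gn : g < 0 by rewrite lt_neqAle gn -normr_gt0 g0.
(* Half of the decay rate [- g] pays for the derivative of [s ^ q] as soon as [s >= q / eta]. *)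
pose eta := - g / 2; have eta0 : 0 < eta by rewrite /eta; lra.
pose K := C / eta; have K0 : 0 <= K by rewrite divr_ge0// ltW.
pose S := Num.max s0 (q%:R / eta).
have s0S : s0 <= S by rewrite le_max lexx.
have Kd s : S <= s ->
    K * (q%:R * s ^+ q.-1 * expR (g * s) + g * ep q g s) <= - (C * ep q g s).
  move=> ss; have s1 : 1 <= s by lra.
  have hq : q%:R <= eta * s.
    rewrite mulrC -ler_pdivrMr//; apply: le_trans ss.
    by rewrite le_max lexx orbT.
  have : q%:R * s ^+ q.-1 <= eta * s ^+ q.
    case: (q) hq => [_|n] /=; first by rewrite expr0 mul0r mulr1 ltW.
    move=> qs.
    have : 0 <= s ^+ n by rewrite exprn_ge0; lra.
    by rewrite exprS; nra.
  move=> /(ler_wpM2r (expR_ge0 (g * s))) h.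
  have e0 : 0 <= expR (g * s) by exact: expR_ge0.
  have -> : - (C * ep q g s) = K * ((eta + g) * ep q g s).
    by rewrite /K /eta; field; rewrite lt_eqF.
  by rewrite ler_wpM2l//; move: h; rewrite /ep; lra.
have mp s t : S <= s -> s <= t ->
    expR (- l * t) * u t + K * ep q g t <= expR (- l * s) * u s + K * ep q g s.
  move=> Ss st; have := derives_nonincr (derivesD Ud (derivesZ K (derives_ep q g))) st.
  move=> /(_ _)/wrap[r /andP[sr _]|//]; have Sr : S <= r by lra.
  by have := Kd r Sr; have := ev r (le_trans s0S Sr); have := ler_norm (expR (- l * r) * v r); lra.
have mm s t : S <= s -> s <= t ->
    expR (- l * s) * u s - K * ep q g s <= expR (- l * t) * u t - K * ep q g t.
  move=> Ss st; have := derives_le (derivesB Ud (derivesZ K (derives_ep q g))) st.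
  move=> /(_ _)/wrap[r /andP[sr _]|//]; have Sr : S <= r by lra.
  have := Kd r Sr; have := ev r (le_trans s0S Sr).
  by have := ler_norm (- (expR (- l * r) * v r)); rewrite normrN; lra.
have B0 s : S <= s -> 0 <= K * ep q g s.
  by move=> Ss; rewrite mulr_ge0// ep_ge0//; lra.
have cross s t : S <= s -> S <= t ->
    expR (- l * s) * u s - K * ep q g s <= expR (- l * t) * u t + K * ep q g t.
  move=> Ss St; have [st|/ltW ts] := leP s t.
    by have := mm _ _ Ss st; have := B0 _ St; lra.
  by have := mp _ _ St ts; have := B0 _ Ss; lra.
(* By [cross] every lower value lies below every upper value, so the supremum of the lower ones is
   squeezed between both at each [s]. *)
pose A := [set expR (- l * s) * u s - K * ep q g s | s in [set s | S <= s]].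
have ubA t : S <= t -> ubound A (expR (- l * t) * u t + K * ep q g t).
  by move=> St _ [s /= Ss <-]; exact: cross.
have Aub : has_ubound A by eexists; exact: (ubA S).
have A0 : A !=set0 by eexists; exists S => //=.
exists (sup A), K, S; split => //; first by lra.
move=> s Ss; have h1 : sup A <= expR (- l * s) * u s + K * ep q g s.
  by apply: ge_sup => //; exact: ubA.
have h2 : expR (- l * s) * u s - K * ep q g s <= sup A.
  by apply: ub_le_sup => //; exists s.
have -> : u s - sup A * ep 0 l s = expR (l * s) * (expR (- l * s) * u s - sup A).
  by rewrite mulrBr -uU /ep expr0; ring.
rewrite normrM ger0_norm ?expR_ge0// -epb [leRHS]mulrCA ler_wpM2l ?expR_ge0//.
by rewrite ler_norml; apply/andP; split; lra.
Qed.

End BigO.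

(* [v] is a combination of the [ep k mu] with [B k mu], modulo [O (ep q be)]. *)
Inductive asym {R : realType} (B : nat -> R -> Prop) (q : nat) (be : R) :
    (R -> R) -> Prop :=
| asym_O v : bO v q be -> asym B q be v
| asym_add c k mu v : B k mu -> asym B q be v ->
    asym B q be (fun s => v s + c * ep k mu s).

(* The modes of a solution of [u' = l u + v] when [v] has modes [B]: the homogeneous
   mode is added, and a resonant mode has its degree raised. *)
Definition step {R : realType} (l : R) (B : nat -> R -> Prop) (k : nat) (mu : R) :=
  B k mu \/ mu = l /\ (k = 0%N \/ B k.-1 l).

Section Asym.
Context {R : realType}.
Implicit Types (u v : R -> R) (l mu be s c : R) (k q : nat) (B : nat -> R -> Prop).

Lemma asym_eq B q be u v : u =1 v -> asym B q be u -> asym B q be v.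
Proof. by move=> /funext ->. Qed.

Lemma asymD B q be u v : asym B q be u -> asym B q be v ->
  asym B q be (fun s => u s + v s).
Proof.
elim=> [{}u uO|c k mu {}u Bk _ IH] vB; last first.
  by apply: (asym_eq _ (asym_add c Bk (IH vB))) => s; ring.
elim: vB => [{}v vO|c k mu {}v Bk _ IH]; first by apply/asym_O/bOD.
by apply: (asym_eq _ (asym_add c Bk IH)) => s; ring.
Qed.

Lemma asymZ B q be c v : asym B q be v -> asym B q be (fun s => c * v s).
Proof.
elim=> [{}v vO|d k mu {}v Bk _ IH]; first exact/asym_O/bOZ.
by apply: (asym_eq _ (asym_add (c * d) Bk IH)) => s; ring.
Qed.

Lemma bO0 q be : bO (fun=> 0 : R) q be.
Proof.
by exists 0, 1; split => // s _; rewrite normr0 mul0r.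
Qed.

Lemma asym_ep B q be k mu : B k mu \/ negl k mu q be -> asym B q be (ep k mu).
Proof.
case=> [Bk|n]; last by apply/asym_O/(bO_weaken n)/bO_ep.
by apply: (asym_eq _ (asym_add 1 Bk (asym_O B (bO0 q be)))) => s; ring.
Qed.

Lemma asym_drop B B' q be v : (forall k mu, B k mu -> B' k mu \/ negl k mu q be) ->
  asym B q be v -> asym B' q be v.
Proof.
move=> BB; elim=> [{}v vO|c k mu {}v Bk _ IH]; first exact: asym_O.
by apply: asymD => //; apply: asymZ; apply/asym_ep/BB.
Qed.

Lemma asym_weaken B B' q be q' be' v :
  (forall k mu, B k mu -> B' k mu \/ negl k mu q' be') -> negl q be q' be' ->
  asym B q be v -> asym B' q' be' v.
Proof.
move=> BB n; elim=> [{}v vO|c k mu {}v Bk _ IH]; first exact/asym_O/(bO_weaken n).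
by apply: asymD => //; apply: asymZ; apply/asym_ep/BB.
Qed.

Lemma asymM B1 B2 B q1 be1 q2 be2 q be u v :
  (forall k mu k' mu', B1 k mu -> B2 k' mu' ->
     B (k + k')%N (mu + mu') \/ negl (k + k') (mu + mu') q be) ->
  (forall k mu, B1 k mu -> negl (k + q2) (mu + be2) q be) ->
  (forall k mu, B2 k mu -> negl (q1 + k) (be1 + mu) q be) ->
  negl (q1 + q2) (be1 + be2) q be ->
  asym B1 q1 be1 u -> asym B2 q2 be2 v -> asym B q be (fun s => u s * v s).
Proof.
move=> B12 Be1 Be2 Be uB vB.
elim: uB => [{}u uO|c k mu {}u Bk _ IH].
  elim: vB => [{}v vO|c k mu {}v Bk _ IH].
    by apply/asym_O/(bO_weaken Be)/bOM.
  have : asym B q be (fun s => c * (u s * ep k mu s)).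
    by apply: asymZ; apply/asym_O/(bO_weaken (Be2 _ _ Bk))/bOM => //; exact: bO_ep.
  by move=> /(asymD IH); apply: asym_eq => s; ring.
have : asym B q be (fun s => c * (ep k mu s * v s)).
  apply: asymZ; elim: vB {IH} => [{}v vO|d k' mu' {}v Bk' _ IH].
    by apply/asym_O/(bO_weaken (Be1 _ _ Bk))/bOM => //; exact: bO_ep.
  have : asym B q be (fun s => d * ep (k + k') (mu + mu') s).
    by apply: asymZ; apply/asym_ep/B12.
  by move=> /(asymD IH); apply: asym_eq => s; rewrite -epD; ring.
by move=> /(asymD IH); apply: asym_eq => s; ring.
Qed.

(** Away from resonance, [ep k.+1 mu] is solved up to a multiple of [ep k mu], so the induction
    needs [B] closed under lowering the degree. At resonance, [ep k.+1 l / k.+1] is a solution. *)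
Lemma ep_particular B q be l k mu : (forall k mu, B k.+1 mu -> B k mu) -> B k mu ->
  exists2 e, derives e (fun s => l * e s + ep k mu s) & asym (step l B) q be e.
Proof.
move=> Bd; have [->|ml] := eqVneq mu l.
  move=> Bk; exists (fun s => (k.+1%:R)^-1 * ep k.+1 l s).
    refine (derives_eq (derivesZ _ (derives_ep k.+1 l)) _) => s /=.
    by rewrite /ep; field; rewrite nat1r pnatr_eq0.
  by apply: asymZ; apply: asym_ep; left; right; split => //; right.
have ml0 : mu - l != 0 by rewrite subr_eq0.
elim: k => [|k IH] Bk.
  exists (fun s => (mu - l)^-1 * ep 0 mu s).
    refine (derives_eq (derivesZ _ (derives_ep 0 mu)) _) => s /=.
    by rewrite /ep expr0; field.
  by apply: asymZ; apply: asym_ep; do 2 left.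
have [e de ae] := IH (Bd _ _ Bk).
exists (fun s => (mu - l)^-1 * (ep k.+1 mu s - k.+1%:R * e s)).
  refine (derives_eq (derivesZ _ (derivesB (derives_ep k.+1 mu) (derivesZ _ de))) _).
  by move=> s; rewrite /ep /=; field.
apply: asymZ; apply: (asym_eq (u := fun s => ep k.+1 mu s + - k.+1%:R * e s)).
  by move=> s; ring.
by apply: asymD; [apply: asym_ep; do 2 left|exact: asymZ].
Qed.

Lemma asym_solve B q be l u v : (forall k mu, B k.+1 mu -> B k mu) -> l != be ->
  asym B q be v -> derives u (fun s => l * u s + v s) -> asym (step l B) q be u.
Proof.
move=> Bd lb vB; elim: vB u => [{}v vO|c k mu {}v Bk _ IH] u ud.
  have [c uc] := bO_solve lb ud vO.
  have Bl : step l B 0 l by right; split => //; left.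
  by apply: (asym_eq _ (asym_add c Bl (asym_O _ uc))) => s; ring.
have [e de ae] := ep_particular q be l Bd Bk.
have := IH (fun s => u s - c * e s) => /(_ _)/wrap[|h].
  by refine (derives_eq (derivesB ud (derivesZ c de)) _) => s; ring.
by apply: (asym_eq _ (asymD h (asymZ c ae))) => s; ring.
Qed.

(** [asym] may add the same mode several times; the constant sums all its occurrences. *)
Lemma asym_extract B B' q be k mu u :
  (forall k' mu', B k' mu' -> B' k' mu' \/ k' = k /\ mu' = mu) ->
  asym B q be u -> exists c, asym B' q be (fun s => u s - c * ep k mu s).
Proof.
move=> BB; elim=> [{}u uO|c k' mu' {}u Bk _ [d IH]].
  by exists 0; apply: (asym_eq (u := u)) => [s|]; [ring|exact: asym_O].
have [B'k|[-> ->]] := BB _ _ Bk.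
  by exists d; apply: (asym_eq _ (asym_add c B'k IH)) => s; ring.
by exists (d + c); apply: (asym_eq _ IH) => s; ring.
Qed.

Lemma asym_nil B q be u : (forall k mu, ~ B k mu) -> asym B q be u -> bO u q be.
Proof. by move=> nB; case=> // c k mu v /nB. Qed.

Lemma asym_bO B q be u : (forall k mu, B k mu -> negl k mu q be) ->
  asym B q be u -> bO u q be.
Proof.
move=> Bn uB; have : asym (fun _ _ => False) q be u.
  by apply: (asym_drop _ uB) => k mu /Bn; right.
by apply: asym_nil => k mu [].
Qed.

Lemma asym_extract_sum (m n : nat) (l : R) q be u :
  asym (fun k mu => k = 0%N /\ exists2 j, (m <= j < n)%N & mu = j%:R * l) q be u ->
  exists a : nat -> R, bO (fun s => u s - \sum_(m <= j < n) a j * ep 0 (j%:R * l) s) q be.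
Proof.
elim: n u => [|n IH] u uB.
  exists (fun=> 0); apply: (bO_eq (u := u)) => [s|].
    by rewrite big_geq// subr0.
  by apply: asym_nil uB => k mu [_ [j]]; rewrite ltn0 andbF.
have [mn|nm] := leqP m n; last first.
  exists (fun=> 0); apply: (bO_eq (u := u)) => [s|].
    by rewrite big_geq// subr0.
  apply: asym_nil uB => k mu [_ [j /andP[mj jn]]]; lia.
have [|c uc] := @asym_extract _ (fun k mu => k = 0%N /\ exists2 j, (m <= j < n)%N & mu = j%:R * l)
  q be 0 (n%:R * l) u _ uB.
  move=> k mu [-> [j /andP[mj]]]; rewrite ltnS leq_eqVlt => /predU1P[->->|jn ->].
    by right.
  by left; split=> //; exists j => //; rewrite mj.
have [a ua] := IH _ uc.
exists (fun j => if j == n then c else a j); apply: bO_eq ua => s.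
rewrite big_nat_recr//= eqxx opprD addrA addrAC; congr (_ - _ - _).
by apply: eq_big_nat => j /andP[_ jn]; rewrite ltn_eqF.
Qed.

(* A bounded solution has no component on the growing exponential. *)
Lemma asym_solve_bounded B q be l u v (M s0 : R) :
  (forall k mu, B k.+1 mu -> B k mu) -> (forall k mu, B k mu -> mu < 0) ->
  be < 0 -> 0 < l -> asym B q be v -> derives u (fun s => l * u s + v s) ->
  (forall s, s0 <= s -> `|u s| <= M) -> asym B q be u.
Proof.
move=> Bd B0 be0 l0 vB ud uM.
have lb : l != be by rewrite gt_eqF//; lra.
have uB := asym_solve Bd lb vB ud.
have [c uc] : exists c, asym B q be (fun s => u s - c * ep 0 l s).
  apply: asym_extract uB => k mu [Bk|[->]]; first by left.
  by case=> [->|/B0]; [right|lra].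
have [C [s1 [C0 s11 hC]]] : bO (fun s => u s - c * ep 0 l s) 0 0.
  apply: asym_bO (asym_weaken _ _ uc) => [k mu bk||]; first exact: bk.
    by move=> k mu /B0; right; left.
  by left.
suff c0 : c = 0 by apply: (asym_eq _ uc) => s; rewrite c0; ring.
apply/eqP; rewrite -normr_le0 leNgt; apply/negP => c0.
(* Late enough that [|c| * exp (l s)] exceeds [M + C], by [1 + x <= exp x]. *)
pose s := Num.max (Num.max s0 s1) ((M + C) / `|c| / l).
have ss0 : s0 <= s by rewrite !le_max lexx.
have ss1 : s1 <= s by rewrite !le_max lexx orbT.
have : (M + C) / `|c| / l <= s by rewrite !le_max lexx !orbT.
rewrite ler_pdivrMr// => h.
have : (M + C) / `|c| < expR (l * s).
  by apply: le_lt_trans h _; rewrite mulrC; have := expR_ge1Dx (l * s); lra.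
rewrite ltr_pdivrMr//.
have := hC _ ss1; have := uM _ ss0.
rewrite /ep !expr0 !mul1r mul0r expR0 mulr1 => h1 h2.
have : `|c * expR (l * s)| <= M + C.
  have -> : c * expR (l * s) = u s - (u s - c * expR (l * s)) by ring.
  by apply: le_trans (ler_normB _ _) _; lra.
by rewrite normrM [ `|expR _|]ger0_norm ?expR_ge0// mulrC; lra.
Qed.

End Asym.

(** * The nonlinearity *)

(** The binomial coefficient of [q] over [j] times [L ^ (q - j)]. The recursion through [q - 1]
    mirrors differentiation of the Taylor polynomial. *)
Fixpoint powR_coef {R : realType} (L q : R) (j : nat) : R :=
  if j is i.+1 then q / j%:R * powR_coef L (q - 1) i else L `^ q.

Definition powR_rem {R : realType} (L p y : R) : R :=
  (L + y) `^ p - L `^ p - p * L `^ (p - 1) * y.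

Section PowR.
Context {R : realType}.
Implicit Types (L p q y : R).

Lemma MVT0 (f df : R -> R) (r y : R) : (forall x, `|x| <= r -> is_derive x (1 : R) f (df x)) ->
  `|y| <= r -> exists2 c, `|c| <= `|y| & f y - f 0 = df c * y.
Proof.
move=> fd yr; have [y0|/ltW y0] := leP 0 y.
  have yr' : y <= r by rewrite -(ger0_norm y0).
  have [||c] := @MVT_segment R f df 0 y y0.
  - move=> x; rewrite in_itv /= => /andP[x0 xy]; apply: fd.
    by rewrite gtr0_norm//; lra.
  - apply: derivable_within_continuous => x; rewrite in_itv /= => /andP[x0 xy].
    by have [] : is_derive x (1 : R) f (df x) by apply: fd; rewrite ger0_norm//; lra.
  rewrite in_itv /= => /andP[c0 cy] e; exists c; last by rewrite e subr0.
  by rewrite !ger0_norm.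
have yr' : - r <= y by move: yr; rewrite ler0_norm// => ?; lra.
have [||c] := @MVT_segment R f df y 0 y0.
- move=> x; rewrite in_itv /= => /andP[x0 xy]; apply: fd.
  by rewrite ltr0_norm//; lra.
- apply: derivable_within_continuous => x; rewrite in_itv /= => /andP[x0 xy].
  by have [] : is_derive x (1 : R) f (df x) by apply: fd; rewrite ler0_norm//; lra.
rewrite in_itv /= => /andP[c0 cy] e; exists c.
  by rewrite !ler0_norm// lerN2.
by rewrite -opprB e sub0r mulrN opprK.
Qed.

Lemma derives_exprn k : derives (fun s : R => s ^+ k) (fun s => k%:R * s ^+ k.-1).
Proof.
elim: k => [|k IH]; first by refine (derives_eq (derives_cst _) _) => s; rewrite mul0r.
have -> : (fun s : R => s ^+ k.+1) = fun s => s * s ^+ k.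
  by apply/funext => s; rewrite exprS.
refine (derives_eq (derivesM derives_id IH) _) => s /=.
by case: k {IH} => [|k] /=; rewrite -?[in RHS]natr1 ?exprS; ring.
Qed.

Lemma derives_poly (a : nat -> R) M : derives (fun y => \sum_(0 <= j < M) a j * y ^+ j)
  (fun y => \sum_(0 <= j < M) a j * (j%:R * y ^+ j.-1)).
Proof.
elim: M => [|M IH].
  have -> : (fun y => \sum_(0 <= j < 0) a j * y ^+ j) = fun=> 0.
    by apply/funext => y; rewrite big_geq.
  by refine (derives_eq (derives_cst _) _) => s; rewrite big_geq.
have -> : (fun y => \sum_(0 <= j < M.+1) a j * y ^+ j) =
    fun y => \sum_(0 <= j < M) a j * y ^+ j + a M * y ^+ M.
  by apply/funext => y; rewrite big_nat_recr.
refine (derives_eq (derivesD IH (derivesZ (a M) (derives_exprn M))) _) => s.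
by rewrite big_nat_recr.
Qed.

(** Induction on the order, for all exponents at once: the error has derivative [q] times the error
    for [q - 1] at the previous order, and the mean value theorem adds a factor [y]. The range
    [|y| <= L / 2] keeps [L + y] away from 0, whatever the sign of [q]. *)
Lemma powR_taylor L q M : 0 < L -> exists C, 0 <= C /\ forall y, `|y| <= L / 2 ->
  `|(L + y) `^ q - \sum_(0 <= j < M) powR_coef L q j * y ^+ j| <= C * `|y| ^+ M.
Proof.
move=> L0; elim: M q => [|M IH] q.
  exists ((L / 2) `^ q + (L / 2 * 3) `^ q); split; first by rewrite addr_ge0// powR_ge0.
  move=> y; rewrite ler_norml => /andP[y1 y2].
  rewrite big_geq// subr0 expr0 mulr1 ger0_norm ?powR_ge0//.
  have [q0|/ltW q0] := leP 0 q.
    apply: (@le_trans _ _ ((L / 2 * 3) `^ q)); last by rewrite lerDr powR_ge0.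
    by rewrite ge0_ler_powR ?nnegrE; lra.
  apply: (@le_trans _ _ ((L / 2) `^ q)); last by rewrite lerDl powR_ge0.
  have h a : 0 < a -> a `^ q = (a `^ (- q))^-1.
    by move=> a0; rewrite powRN invrK.
  rewrite !h; [|lra|lra].
  rewrite lef_pV2 ?posrE ?powR_gt0; [|by lra..].
  by rewrite ge0_ler_powR ?nnegrE; lra.
have [C [C0 hC]] := IH (q - 1).
exists (`|q| * C); split; first by rewrite mulr_ge0.
move=> y yL.
pose f y := (L + y) `^ q - \sum_(0 <= j < M.+1) powR_coef L q j * y ^+ j.
pose df y := q * ((L + y) `^ (q - 1) - \sum_(0 <= j < M) powR_coef L (q - 1) j * y ^+ j).
have fd x : `|x| <= L / 2 -> is_derive x (1 : R) f (df x).
  rewrite ler_norml => /andP[x1 x2].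
  have d1 := derivesD (derives_cst L) derives_id x.
  have d2 : is_derive (L + x) (1 : R) ((powR (R:=R))^~ q) (q * (L + x) `^ (q - 1)).
    by apply: is_derive1_powR; lra.
  have d3 := is_derive1_comp d2 d1.
  have d4 := derives_poly (powR_coef L q) M.+1 x.
  apply: (is_derive_eq (is_deriveB d3 d4)).
  rewrite /df add0r mulr1 mulrBr; congr (_ - _).
  rewrite big_nat_recl//= mul0r mulr0 add0r mulr_sumr; apply: eq_big_nat => j _.
  by field; rewrite nat1r pnatr_eq0.
have [c cy e] := MVT0 fd yL.
have f0 : f 0 = 0.
  rewrite /f addr0 big_nat_recl//= expr0 mulr1 big1_seq ?addr0 ?subrr//.
  by move=> j _; rewrite expr0n mulr0.
have -> : (L + y) `^ q - \sum_(0 <= j < M.+1) powR_coef L q j * y ^+ j = df c * y.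
  by rewrite -e f0 subr0.
rewrite /df !normrM exprSr mulrA -[leRHS]mulrA -[leRHS]mulrA.
rewrite -mulrA ler_wpM2l// [leRHS]mulrA ler_wpM2r//.
apply: le_trans (hC c _) _; first exact: le_trans cy yL.
by rewrite ler_wpM2l// lerXn2r ?nnegrE.
Qed.

Lemma powR_pred L p : 0 < L -> L `^ (p - 1) * L = L `^ p.
Proof.
move=> L0; rewrite -[X in _ * X]powRr1 ?ltW// -powRD ?subrK//.
by apply/implyP => _; rewrite gt_eqF.
Qed.

Lemma powR_rem_taylor L p M : 0 < L -> exists C, 0 <= C /\ forall y, `|y| <= L / 2 ->
  `|powR_rem L p y - \sum_(2 <= j < M.+2) powR_coef L p j * y ^+ j| <= C * `|y| ^+ M.+2.
Proof.
move=> L0; have [C [C0 hC]] := powR_taylor p M.+2 L0.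
exists C; split => // y /hC; rewrite big_ltn// big_ltn//= expr0 expr1 mulr1.
rewrite divr1 addrA opprD addrA; congr (`|_ - _| <= _).
by rewrite /powR_rem; ring.
Qed.

(** Young's inequality for [L + y] and [L ^ (p - 1)] with conjugate exponents [p] and [p / (p - 1)],
    multiplied by [p]. *)
Lemma powR_rem_ge0 L p y : 0 < L -> 1 < p -> 0 < L + y -> 0 <= powR_rem L p y.
Proof.
move=> L0 p1 Ly0; pose q := p / (p - 1).
have p0 : 0 < p - 1 by lra.
have q0 : 0 < q by rewrite /q divr_gt0//; lra.
have pq : p^-1 + q^-1 = 1 by rewrite /q; field; rewrite !gt_eqF//; lra.
have := conjugate_powR (ltW Ly0) (powR_ge0 L (p - 1)) (lt_trans ltr01 p1) q0 pq.
have -> : (L `^ (p - 1)) `^ q = L `^ p.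
  by rewrite -powRrM /q mulrC divfK// gt_eqF.
have -> : (L + y) `^ p / p + L `^ p / q = ((L + y) `^ p + (p - 1) * L `^ p) / p.
  by rewrite /q; field; rewrite !gt_eqF//; lra.
rewrite ler_pdivlMr; last by lra.
by rewrite /powR_rem -(powR_pred p L0); lra.
Qed.

Lemma powR_rem_superlinear L p : 0 < L -> 1 < p ->
  exists ys, forall y, ys <= y -> 2^-1 * y `^ p <= powR_rem L p y.
Proof.
move=> L0 p1; have p0 : 0 < p - 1 by lra.
(* For [y >= 1] the terms subtracted in [powR_rem] add up to at most [A * y / 2], which is at most
   [y ^ p / 2] once [y ^ (p - 1) >= A]. *)
pose A := 2 * (L `^ p + p * L `^ (p - 1)).
have A0 : 0 < A.
  by rewrite mulr_gt0// addr_gt0 ?powR_gt0// mulr_gt0 ?powR_gt0//; lra.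
exists (Num.max 1 (A `^ (p - 1)^-1)) => y; rewrite ge_max => /andP[y1 yA].
have yp : A <= y `^ (p - 1).
  have -> : A = (A `^ (p - 1)^-1) `^ (p - 1).
    by rewrite -powRrM mulVf ?gt_eqF// powRr1// ltW.
  by rewrite ge0_ler_powR ?nnegrE ?powR_ge0//; lra.
have y0 : 0 < y by lra.
have e1 := powR_pred p y0.
have m : y `^ p <= (L + y) `^ p by rewrite ge0_ler_powR ?nnegrE; lra.
have : A * y <= y `^ p by rewrite -e1 ler_pM2r.
have : L `^ p <= L `^ p * y by rewrite ler_peMr// powR_ge0.
by rewrite /powR_rem /A; lra.
Qed.

End PowR.

(** * The eigenvalues and the thresholds *)

(* [Q4 (a - x) = quartic a (x ^ 2)] when [a = (n - 4) / 2]. *)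
Definition quartic {R : realType} (a s : R) : R := (a ^+ 2 - s) * ((a + 2) ^+ 2 - s).

(* [p * Q4 (m)] as a function of [u = a - m], after eliminating [p = (m + 4) / m]. *)
Definition shifted_source {R : realType} (a u : R) : R :=
  ((a + 2) ^+ 2 - (u - 2) ^+ 2) * ((a + 2) ^+ 2 - u ^+ 2).

(** The characteristic polynomial at the points [x] with [(x + u)^2 = w u^2], where [- u] is the
    centre of the spectrum. *)
Definition resonance {R : realType} (a w u : R) : R :=
  quartic a (w * u ^+ 2) - shifted_source a u.

Section Resonance.
Context {R : realType}.
Implicit Types (a w u v : R).

Let slope a w u v := - (1 - w ^+ 2) * (u + v) * (u ^+ 2 * v ^+ 2) + 4 * (u ^+ 2 * v ^+ 2)
  + 4 * (a + 2) ^+ 2 * (u * v) + 4 * (a + 2) ^+ 2 * a * (u + v).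

(* [resonance a w u / u ^ 2] has the divided differences [slope / (u v) ^ 2]. *)
Let slopeE a w u v : resonance a w v * u ^+ 2 - resonance a w u * v ^+ 2 =
  (v - u) * slope a w u v.
Proof. by rewrite /resonance /quartic /shifted_source /slope; ring. Qed.

(** Concavity of [resonance a w u / u ^ 2]: written in the reciprocals of its arguments, the divided
    difference is a sum of nondecreasing terms. *)
Let slope_mono a w p q u v : 0 < a -> 0 <= w <= 1 -> 0 < u <= p -> 0 < v <= q ->
  0 < slope a w p q -> 0 < slope a w u v.
Proof.
move=> a0 /andP[w0 w1] /andP[u0 up] /andP[v0 vq].
pose f x y : R := - (1 - w ^+ 2) * (x^-1 + y^-1) + 4 + 4 * (a + 2) ^+ 2 * (x * y)
  + 4 * (a + 2) ^+ 2 * a * (x * y * (x + y)).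
have fE x y : 0 < x -> 0 < y -> slope a w x y = x ^+ 2 * y ^+ 2 * f x^-1 y^-1.
  by move=> x0 y0; rewrite /slope /f; field; rewrite !gt_eqF.
have p0 : 0 < p by lra.
have q0 : 0 < q by lra.
rewrite !fE// !pmulr_rgt0 ?mulr_gt0 ?exprn_gt0// => h.
apply: lt_le_trans h _; rewrite /f !invrK.
have ip : 0 < p^-1 by rewrite invr_gt0.
have iq : 0 < q^-1 by rewrite invr_gt0.
have hp : p^-1 <= u^-1 by rewrite lef_pV2.
have hq : q^-1 <= v^-1 by rewrite lef_pV2.
have pq : p^-1 * q^-1 <= u^-1 * v^-1 by rewrite ler_pM// ltW.
have w2 : 0 <= 1 - w ^+ 2 by nra.
have b0 : 0 < 4 * (a + 2) ^+ 2 by rewrite mulr_gt0 ?exprn_gt0//; lra.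
apply: lerD.
  apply: lerD; last by rewrite ler_pM2l.
  by rewrite lerD2r !mulNr lerN2 ler_wpM2l//; lra.
rewrite ler_pM2l; last by rewrite mulr_gt0.
by apply: ler_pM => //; [apply: mulr_ge0; exact: ltW|rewrite addr_ge0 ?ltW|exact: lerD].
Qed.

(** [slope a w a a / a ^ 4] is the derivative of [resonance a w u / u ^ 2] at [u = a]. In terms of
    [z = a (1 - w)], the sign of the resonance bounds [z] from above, and a small [z] makes the
    negative term of the slope harmless. *)
Let slope_end a w : 1 <= a -> 0 <= w <= 1 -> resonance a w a <= 0 -> 0 < slope a w a a.
Proof.
move=> a1 /andP[w0 w1] h; pose z := a * (1 - w).
have z0 : 0 <= z by rewrite mulr_ge0; lra.
have hz : z * (a * z + 4 * a + 4) <= 32 * (a + 1).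
  have : a * (z * (a * z + 4 * a + 4) - 32 * (a + 1)) <= 0.
    by move: h; rewrite /resonance /quartic /shifted_source /z; lra.
  by rewrite pmulr_rle0; lra.
(* [a z ^ 2] is replaced by its tangent at [z = 4], the limit as [a] grows of the value at which
   [hz] is an equality. The slope bound, [4 a ^ 2 z] against [16 a ^ 2] at leading order, is also
   tight there. *)
have zb : z * (3 * a + 1) <= 12 * a + 8.
  rewrite leNgt; apply/negP => hh.
  have : 0 <= a * (z - 4) ^+ 2 by rewrite mulr_ge0 ?exprn_even_ge0//; lra.
  by move: hz hh; clearbody z; lra.
have -> : slope a w a a = a ^+ 2 * (- 2 * a ^+ 2 * (z * (1 + w)) + 4 * a ^+ 2 + 12 * (a + 2) ^+ 2).
  by rewrite /slope /z; ring.
rewrite pmulr_rgt0; last by rewrite exprn_gt0; lra.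
have : z * (1 + w) <= 2 * z by nra.
have : 4 * a ^+ 2 * z < 4 * a ^+ 2 + 12 * (a + 2) ^+ 2.
  have : 4 * a ^+ 2 * (z * (3 * a + 1)) <= 4 * a ^+ 2 * (12 * a + 8).
    by rewrite ler_wpM2l// mulr_ge0// exprn_ge0; lra.
  move: z zb {hz z0} => z zb h1.
  have : 4 * a ^+ 2 * z * (3 * a + 1) < (4 * a ^+ 2 + 12 * (a + 2) ^+ 2) * (3 * a + 1).
    apply: (@le_lt_trans _ _ (4 * a ^+ 2 * (12 * a + 8))); first by move: h1; lra.
    have : 0 <= a ^+ 3 by rewrite exprn_ge0; lra.
    have : 0 <= a ^+ 2 by rewrite exprn_ge0; lra.
    lra.
  by rewrite ltr_pM2r//; lra.
have a2 : 0 <= a ^+ 2 by rewrite exprn_ge0; lra.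
move=> h1 /(ler_wpM2l a2); move: h1; clearbody z; lra.
Qed.

(** If the resonance is nonpositive at [a], [slope_end] and concavity give a positive slope on
    [[u, a]], against the signs at its ends. If it is positive at [a] but nonpositive at [v], the
    slope is positive on [[v, a]], hence on [[u, v]], again against the signs. *)
Lemma resonance_crossing a w u v : 1 <= a -> 0 <= w <= 1 -> 0 < u -> u < v -> v <= a ->
  0 <= resonance a w u -> 0 < resonance a w v.
Proof.
move=> a1 w01 u0 uv va ru.
have [ra|ra] := leP (resonance a w a) 0.
  have s0 : 0 < slope a w u a.
    by apply: slope_mono (slope_end a1 w01 ra);
      [lra|by []|rewrite u0 /=; lra|rewrite lexx andbT; lra].
  have := slopeE a w u a; have : 0 < (a - u) * slope a w u a by rewrite mulr_gt0//; lra.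
  have : resonance a w a * u ^+ 2 <= 0 by rewrite mulr_le0_ge0// exprn_ge0// ltW.
  have : 0 <= resonance a w u * a ^+ 2 by rewrite mulr_ge0// exprn_ge0//; lra.
  lra.
rewrite ltNge; apply/negP => rv.
have {}va : v < a.
  by rewrite lt_neqAle va andbT; apply/eqP => e; move: rv; rewrite e; lra.
have v0 : 0 < v by lra.
have s0 : 0 < slope a w v a.
  have : 0 < (a - v) * slope a w v a.
    rewrite -slopeE; have : 0 < resonance a w a * v ^+ 2 by rewrite mulr_gt0// exprn_gt0.
    by have : resonance a w v * a ^+ 2 <= 0; [rewrite mulr_le0_ge0// exprn_ge0//; lra|lra].
  by rewrite pmulr_rgt0//; lra.
have : 0 < slope a w u v.
  by apply: slope_mono s0; [lra|by []|rewrite u0 ltW|rewrite v0 ltW].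
have : (v - u) * slope a w u v <= 0.
  rewrite -slopeE; have : 0 <= resonance a w u * v ^+ 2 by rewrite mulr_ge0// exprn_ge0// ltW.
  by have : resonance a w v * u ^+ 2 <= 0; [rewrite mulr_le0_ge0// exprn_ge0// ltW|lra].
by rewrite pmulr_rle0; lra.
Qed.

Lemma resonance_at0 a w : 1 <= a -> resonance a w 0 < 0.
Proof.
move=> a1; have -> : resonance a w 0 = - (4 * a * (a + 2) ^+ 2).
  by rewrite /resonance /quartic /shifted_source; ring.
by rewrite oppr_lt0 mulr_gt0 ?exprn_gt0//; lra.
Qed.

Lemma continuous_resonance a w : continuous (resonance a w).
Proof.
pose P := (a ^+ 2)%:P - w *: 'X^2.
pose Q := ((a + 2) ^+ 2)%:P - w *: 'X^2.
pose S := ((a + 2) ^+ 2)%:P - ('X - 2%:P) ^+ 2.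
pose T := ((a + 2) ^+ 2)%:P - 'X^2.
have -> : resonance a w = horner (P * Q - S * T).
  by apply/funext => u; rewrite /resonance /quartic /shifted_source /P /Q /S /T !hornerE.
exact: continuous_horner.
Qed.

Lemma resonance_root a w v : 1 <= a -> 0 < v -> 0 <= resonance a w v ->
  exists2 u, 0 < u <= v & resonance a w u = 0.
Proof.
move=> a1 v0 rv; have r0 := resonance_at0 w a1.
have [||u] := @IVT R (resonance a w) 0 v 0 (ltW v0).
- by apply: continuous_subspaceT => x; exact: continuous_resonance.
- by rewrite ge_min le_max (ltW r0) rv orbT.
rewrite in_itv /= => /andP[u0 uv] ru; exists u => //.
rewrite uv andbT lt_neqAle u0 andbT; apply/eqP => e.
by move: r0; rewrite {1}e ru ltxx.
Qed.

Lemma resonance_decr a w w' u : 0 < u < a -> w < w' -> w' <= 1 ->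
  resonance a w' u < resonance a w u.
Proof.
move=> /andP[u0 ua] ww w1; rewrite /resonance ltrD2r -subr_gt0 /quartic.
have -> : (a ^+ 2 - w * u ^+ 2) * ((a + 2) ^+ 2 - w * u ^+ 2) -
  (a ^+ 2 - w' * u ^+ 2) * ((a + 2) ^+ 2 - w' * u ^+ 2) =
  (w' - w) * u ^+ 2 * ((a ^+ 2 - w' * u ^+ 2) + ((a + 2) ^+ 2 - w * u ^+ 2)) by ring.
have u2 : u ^+ 2 < a ^+ 2 by rewrite ltrXn2r// ?nnegrE; lra.
have : w * u ^+ 2 <= u ^+ 2 by rewrite ler_piMl// ?exprn_ge0; lra.
have : w' * u ^+ 2 <= u ^+ 2 by rewrite ler_piMl// exprn_ge0// ltW.
have : (a + 2) ^+ 2 = a ^+ 2 + 4 * a + 4 by ring.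
by move=> *; rewrite !mulr_gt0 ?exprn_gt0//; lra.
Qed.

End Resonance.

(* [l2 <= k * l3] amounts to [0 <= resonance a (weight k) u]. *)
Definition weight {R : realType} (k : nat) : R := ((k%:R - 1) / (k%:R + 1)) ^+ 2.

Section Spectrum.
Context {R : realType}.
Implicit Types (a w u v : R).

Lemma poly_ext (p q : {poly R}) : (forall x, p.[x] = q.[x]) -> p = q.
Proof.
move=> pq; apply/eqP; rewrite -subr_eq0; apply/eqP.
apply: (@roots_geq_poly_eq0 R _ [seq i%:R | i <- iota 0 (size (p - q))]).
- by apply/allP => x _; rewrite rootE hornerD hornerN pq subrr.
- rewrite map_inj_uniq ?iota_uniq// => i j /eqP.
  by rewrite eqr_nat => /eqP.
- by rewrite size_map size_iota.
Qed.

Lemma Q4E (n : nat) (x : R) : let a := (n%:R - 4) / 2 in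
  (Q4 n).[a - x] = quartic a (x ^+ 2).
Proof.
by move=> a; rewrite /Q4 !(hornerM, hornerD, hornerX, hornerC) /quartic /a; field.
Qed.

(** In the variable [(x + u)^2] the characteristic polynomial is quadratic with roots [s2 < s1].
    Real [l2] and [l3] amount to [0 <= s2], which is the resonance condition at weight 0;
    [s2 < u ^ 2 < s1] gives the signs of [l3] and [l4]. *)
Lemma spectrum a u : 0 < u < a -> 0 <= resonance a 0 u -> exists l1 l2 l3 l4 : R,
  [/\ [/\ l1 < l2, l2 <= l3, l3 < 0 & 0 < l4], l1 + l4 = l2 + l3, l2 + l3 = - 2 * u,
    (forall x, (x - l1) * (x - l2) * (x - l3) * (x - l4) =
       quartic a ((x + u) ^+ 2) - shifted_source a u) &
    (forall k, (1 <= k)%N -> (l2 <= k%:R * l3) = (0 <= resonance a (weight k) u) /\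
       (l2 < k%:R * l3) = (0 < resonance a (weight k) u))].
Proof.
move=> /andP[u0 ua] r0.
(* Completing the square: [a ^ 2] and [(a + 2) ^ 2] lie at distance [2 (a + 1)] from their mean. *)
pose y := Num.sqrt (shifted_source a u + 4 * (a + 1) ^+ 2).
pose s2 := (a ^+ 2 + (a + 2) ^+ 2) / 2 - y.
pose s1 := (a ^+ 2 + (a + 2) ^+ 2) / 2 + y.
have a0 : 0 < a by lra.
have K0 : 0 < shifted_source a u.
  by rewrite /shifted_source mulr_gt0// subr_gt0; nra.
have a2 : 0 < 4 * (a + 1) ^+ 2 by rewrite mulr_gt0// exprn_gt0; lra.
have y2 : y ^+ 2 = shifted_source a u + 4 * (a + 1) ^+ 2.
  by rewrite sqr_sqrtr//; lra.
have y0 : 0 < y by rewrite sqrtr_gt0; lra.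
have fac x : quartic a x - shifted_source a u = (x - s1) * (x - s2).
  have -> : shifted_source a u = y ^+ 2 - 4 * (a + 1) ^+ 2 by rewrite y2; ring.
  by rewrite /quartic /s1 /s2; field.
have s12 : s2 < s1 by rewrite /s1 /s2; lra.
have s1a : a ^+ 2 < s1 by rewrite /s1; nra.
have ua2 : u ^+ 2 < a ^+ 2 by rewrite ltrXn2r// ?nnegrE; lra.
have s20 : 0 <= s2.
  have : 0 <= s1 * s2.
    by move: r0; rewrite /resonance mul0r fac !sub0r mulrNN.
  by rewrite pmulr_rge0//; nra.
have s2u : s2 < u ^+ 2.
  have : 0 < (s1 - u ^+ 2) * (u ^+ 2 - s2).
    have -> : (s1 - u ^+ 2) * (u ^+ 2 - s2) = shifted_source a u - quartic a (u ^+ 2).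
      have := fac (u ^+ 2); lra.
    have -> : shifted_source a u - quartic a (u ^+ 2) = 4 * (a + u) * ((a + 2) ^+ 2 - u ^+ 2).
      by rewrite /shifted_source /quartic; ring.
    by rewrite !mulr_gt0//; nra.
  by rewrite pmulr_rgt0; lra.
pose r1 := Num.sqrt s1; pose r2 := Num.sqrt s2.
have r1E : r1 ^+ 2 = s1 by rewrite sqr_sqrtr//; nra.
have r2E : r2 ^+ 2 = s2 by rewrite sqr_sqrtr.
have r10 : 0 < r1 by rewrite sqrtr_gt0; nra.
have r20 : 0 <= r2 by exact: sqrtr_ge0.
have r2u : r2 < u by rewrite -(@ltr_pXn2r R 2)// ?nnegrE ?r2E// ltW.
have r12 : r2 < r1 by rewrite ltr_sqrt//; nra.
have r1u : u < r1 by rewrite -(@ltr_pXn2r R 2)// ?nnegrE ?r1E ?ltW//; lra.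
exists (- u - r1), (- u - r2), (- u + r2), (- u + r1); split; [split; lra|lra|lra| |].
  move=> x; rewrite fac -r1E -r2E; ring.
(* With [l2, l3 = - u -+ r2], the inequality [l2 <= k l3] reads [(k - 1) u <= (k + 1) r2]. *)
move=> k k1; pose c : R := (k%:R - 1) / (k%:R + 1).
have k1R : (1 : R) <= k%:R by rewrite ler1n.
have c01 : 0 <= c < 1.
  by rewrite divr_ge0 ?ltr_pdivrMr /=; lra.
have cE : c * (k%:R + 1) = k%:R - 1 by rewrite divfK// gt_eqF//; lra.
have wu : weight k * u ^+ 2 = (c * u) ^+ 2 by rewrite exprMn.
have cu : 0 <= c * u by rewrite mulr_ge0//; lra.
have cu1 : (c * u) ^+ 2 < s1.
  apply: lt_trans s1a; apply: le_lt_trans ua2; rewrite lerXn2r// ?nnegrE ?(ltW u0)//.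
  by rewrite ler_piMl//; lra.
have -> : (- u - r2 <= k%:R * (- u + r2)) = (c * u <= r2).
  rewrite -subr_ge0 -[RHS]subr_ge0.
  have -> : k%:R * (- u + r2) - (- u - r2) = (k%:R + 1) * (r2 - c * u).
    by rewrite mulrBr mulrA [_ * c]mulrC cE; ring.
  by rewrite pmulr_rge0//; lra.
have -> : (- u - r2 < k%:R * (- u + r2)) = (c * u < r2).
  rewrite -subr_gt0 -[RHS]subr_gt0.
  have -> : k%:R * (- u + r2) - (- u - r2) = (k%:R + 1) * (r2 - c * u).
    by rewrite mulrBr mulrA [_ * c]mulrC cE; ring.
  by rewrite pmulr_rgt0//; lra.
have fE : resonance a (weight k) u = (s1 - (c * u) ^+ 2) * (r2 ^+ 2 - (c * u) ^+ 2).
  by rewrite /resonance wu fac r2E; ring.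
have p1 : 0 < s1 - (c * u) ^+ 2 by rewrite subr_gt0.
rewrite fE (pmulr_rge0 _ p1) (pmulr_rgt0 _ p1) subr_gt0.
by rewrite subr_ge0 ler_pXn2r ?ltr_pXn2r ?nnegrE.
Qed.

End Spectrum.

(** * Finiteness and order of the thresholds *)

Section Thresholds.
Context {R : realType}.
Implicit Types (a w u v : R).

Lemma weight_incr k : (1 <= k)%N -> (weight k : R) < weight k.+1 /\ (weight k.+1 : R) < 1.
Proof.
move=> k1; have k1R : (1 : R) <= k%:R by rewrite ler1n.
have e : (k.+1%:R : R) = k%:R + 1 by rewrite natr1.
have c0 : 0 <= (k%:R - 1) / (k%:R + 1) :> R by rewrite divr_ge0; lra.
have c1 : 0 <= (k%:R + 1 - 1) / (k%:R + 1 + 1) :> R by rewrite divr_ge0; lra.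
split; rewrite /weight e.
  rewrite ltrXn2r// ltr_pdivrMr; last lra.
  by rewrite mulrAC ltr_pdivlMr; [nra|lra].
by rewrite -[ltRHS](expr1n _ 2) ltrXn2r// ltr_pdivrMr; lra.
Qed.

Lemma weight01 k : (1 <= k)%N -> 0 <= (weight k : R) <= 1.
Proof.
move=> k1; have [h1 h2] := weight_incr k1.
by rewrite exprn_even_ge0//= ltW// (lt_trans h1).
Qed.

Lemma weight1 : (weight 1 : R) = 0.
Proof. by rewrite /weight subrr mul0r expr0n. Qed.

(** This makes the thresholds finite in number. At weight 1 the resonance is at most
    [- 16 a (a + 1)], and since [1 - weight k <= 4 / k], large [k] cannot make up for it. *)
Lemma weight_resonant a k u : 9 / 2 <= a -> (1 <= k)%N -> 0 < u < a ->
  0 <= resonance a (weight k) u -> k%:R <= a * (a + 2) ^+ 2.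
Proof.
move=> a1 k1 /andP[u0 ua] ru.
have k1R : (1 : R) <= k%:R by rewrite ler1n.
have [w1 w2] := weight_incr k1.
have /andP[w0 _] := weight01 k1.
have kw : (1 - weight k : R) * k%:R <= 4.
  rewrite (_ : 1 - weight k = 4 * k%:R / (k%:R + 1) ^+ 2 :> R); last first.
    by rewrite /weight; field; rewrite gt_eqF//; lra.
  by rewrite mulrAC ler_pdivrMr; [nra|rewrite exprn_gt0//; lra].
have h : 16 * a * (a + 1) <= (1 - weight k) * (a ^+ 2 * (2 * (a + 2) ^+ 2)).
  have -> : 16 * a * (a + 1) = 4 * a * ((a + 2) ^+ 2 - a ^+ 2) by ring.
  have u2 : u ^+ 2 < a ^+ 2 by rewrite ltrXn2r// ltW.
  have e : resonance a (weight k) u = (1 - weight k) * (u ^+ 2 *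
      ((a ^+ 2 + (a + 2) ^+ 2) - (1 + weight k) * u ^+ 2)) -
      4 * (a + u) * ((a + 2) ^+ 2 - u ^+ 2).
    by rewrite /resonance /quartic /shifted_source; ring.
  apply: (@le_trans _ _ (4 * (a + u) * ((a + 2) ^+ 2 - u ^+ 2))).
    apply: ler_pM; [lra| nra| lra|lra].
  apply: (@le_trans _ _ ((1 - weight k) * (u ^+ 2 *
      ((a ^+ 2 + (a + 2) ^+ 2) - (1 + weight k) * u ^+ 2)))); first by lra.
  rewrite ler_wpM2l//; first lra.
  have u20 : 0 <= u ^+ 2 by rewrite exprn_ge0// ltW.
  apply: ler_pM => //; [nra|lra|nra].
have : 16 * a * (a + 1) * k%:R <= 4 * (a ^+ 2 * (2 * (a + 2) ^+ 2)).
  have a20 : 0 <= a ^+ 2 * (2 * (a + 2) ^+ 2) by rewrite !mulr_ge0 ?exprn_ge0//; lra.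
  apply: le_trans (ler_wpM2r (le_trans ler01 k1R) h) _.
  by rewrite mulrAC ler_wpM2r.
have : a * k%:R * a <= a * k%:R * (a + 1) by rewrite ler_wpM2l ?mulr_ge0//; lra.
move=> h1 h2; have : a ^+ 2 * k%:R <= a ^+ 2 * (a * (a + 2) ^+ 2).
  have : 0 <= a ^+ 2 * (a + 2) ^+ 2 * (a - 1) by rewrite !mulr_ge0 ?exprn_ge0//; lra.
  have : 0 <= a ^+ 2 * (a + 2) ^+ 2 by rewrite mulr_ge0 ?exprn_ge0//; lra.
  lra.
by rewrite ler_pM2l ?exprn_gt0//; lra.
Qed.

(** [N] is the last [k] whose resonance is nonnegative somewhere in the range. The resonance
    decreases in the weight, so all smaller [k] qualify and the zeros [uk k] increase. *)
Lemma thresholds a : 9 / 2 <= a -> exists (N : nat) (uk : nat -> R),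
  [/\ (1 <= N)%N, (forall k, (1 <= k <= N)%N -> 0 < uk k < a),
    (forall k, (1 <= k < N)%N -> uk k < uk k.+1),
    (forall k u, (1 <= k <= N)%N -> 0 < u < a ->
      (0 <= resonance a (weight k) u) = (uk k <= u) /\
      (0 < resonance a (weight k) u) = (uk k < u)) &
    (forall u, 0 < u < a -> resonance a (weight N.+1) u < 0)].
Proof.
move=> a1; have a11 : 1 <= a by lra.
pose P k := `[< (1 <= k)%N /\ exists2 u, 0 < u < a & 0 <= resonance a (weight k) u >].
have P1 : P 1%N.
  apply/asboolP; split => //.
  (* The dimension bound shows here: [a (a + 2)^2 > 32 (a + 1)] holds for [a >= 9 / 2] but fails at
     [a = 4], that is [n = 12]. *)
  have ra : 0 < resonance a (weight 1) a.
    rewrite weight1 /resonance /quartic /shifted_source.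
    have -> : (a ^+ 2 - 0 * a ^+ 2) * ((a + 2) ^+ 2 - 0 * a ^+ 2) -
      ((a + 2) ^+ 2 - (a - 2) ^+ 2) * ((a + 2) ^+ 2 - a ^+ 2) =
      a * (a * (a + 2) ^+ 2 - 32 * (a + 1)) by ring.
    by rewrite mulr_gt0//; nra.
  have [u /andP[u0 ua] ru] := resonance_root a11 (ltac:(lra) : 0 < a) (ltW ra).
  exists u; last by rewrite ru.
  rewrite u0 lt_neqAle ua andbT; apply/eqP => e.
  by move: ra; rewrite -{2}e ru ltxx.
have Pb k : P k -> (k <= Num.bound (a * (a + 2) ^+ 2))%N.
  move=> /asboolP[k1 [u u0 ru]]; have := weight_resonant a1 k1 u0 ru.
  move=> h; rewrite -(ler_nat R) ltW// (le_lt_trans h)// archi_boundP//.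
  by rewrite mulr_ge0 ?exprn_ge0//; lra.
have Pdown k : (1 <= k)%N -> P k.+1 -> P k.
  move=> k1 /asboolP[_ [u u0 ru]]; apply/asboolP; split => //; exists u => //.
  apply: le_trans ru _; apply: ltW; apply: resonance_decr => //.
    by have [] := weight_incr k1.
  by have [_ /ltW] := weight_incr k1.
have exP : exists k, P k by exists 1%N.
have [N [PN maxN]] : exists N, P N /\ forall k, P k -> (k <= N)%N.
  by exists (ex_maxn exP Pb); case: ex_maxnP.
have Pm m : (m < N)%N -> P (N - m)%N.
  elim: m => [|m IH] mN; first by rewrite subn0.
  have := IH (ltnW mN); have -> : (N - m = (N - m.+1).+1)%N by lia.
  by move=> Pm; apply: Pdown Pm; rewrite subn_gt0.
have Pk k : (1 <= k <= N)%N -> P k.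
  by move=> /andP[k1 kN]; rewrite -(subKn kN); apply: Pm; lia.
have /choice[uk hk] : forall k, exists u, (1 <= k <= N)%N ->
    0 < u < a /\ resonance a (weight k) u = 0.
  move=> k; have [/Pk/asboolP[k1 [v /andP[v0 va] rv]]|_] := boolP (1 <= k <= N)%N.
    have [u /andP[u0 uv] ru] := resonance_root a11 v0 rv.
    by exists u => _; rewrite u0 (le_lt_trans uv).
  by exists 0.
have iff1 k u : (1 <= k <= N)%N -> 0 < u < a ->
      (0 <= resonance a (weight k) u) = (uk k <= u) /\
      (0 < resonance a (weight k) u) = (uk k < u).
  move=> kN u0; have /andP[k1 _] := kN; have [/andP[uk0 uka] rk] := hk k kN.
  have w01 := weight01 k1; have /andP[u00 ua] := u0.
  have [lt|lt|<-] := ltgtP (uk k) u; last by rewrite rk lexx ltxx.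
    have h : 0 < resonance a (weight k) u.
      by apply: (resonance_crossing a11 w01 uk0 lt (ltW ua)); rewrite rk.
    by rewrite h ltW.
  have h : resonance a (weight k) u < 0.
    rewrite ltNge; apply/negP => h.
    by have := resonance_crossing a11 w01 u00 lt (ltW uka) h; rewrite rk ltxx.
  by rewrite leNgt h/= ltNge ltW.
exists N, uk; split => //.
- exact: maxN.
- by move=> k /hk[].
- move=> k /andP[k1 kN]; have kN' : (1 <= k <= N)%N by rewrite k1 ltnW.
  have [u0 rk] := hk k.+1 ltac:(lia).
  have [_ <-] := iff1 k (uk k.+1) kN' u0.
  have [h1 h2] := weight_incr k1.
  by rewrite -rk; apply: resonance_decr => //; exact: ltW.
- move=> u u0; rewrite ltNge; apply/negP => h.
  have : P N.+1 by apply/asboolP; split => //; exists u.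
  by move=> /maxN; rewrite ltnn.
Qed.

End Thresholds.

(** * From the drift [u] back to the power [p] *)

Definition half_dim {R : realType} (n : nat) : R := (n%:R - 4) / 2.

(* Minus half the sum of the eigenvalues [l2 + l3 = l1 + l4]. *)
Definition drift {R : realType} (n : nat) (p : R) : R := half_dim n - 4 / (p - 1).

Section Exponents.
Context {R : realType}.
Implicit Types (p q u v : R).

(** With [m = half_dim n - u], the denominator of [p = (m + 4) / m] cancels the factor
    [half_dim n - u] of the quartic, so the source is a polynomial in [u]. *)
Lemma source_drift n p : 1 < p ->
  p * (Q4 n).[4 / (p - 1)] = shifted_source (half_dim n) (drift n p).
Proof.
move=> p1; have -> : 4 / (p - 1) = (n%:R - 4) / 2 - drift n p by rewrite /drift /half_dim; ring.
rewrite Q4E -/(half_dim n) /shifted_source /quartic /drift.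
by field; rewrite gt_eqF//; lra.
Qed.

Lemma Q4_drift n p : (Q4 n).[4 / (p - 1)] = quartic (half_dim n) (drift n p ^+ 2).
Proof.
have -> : 4 / (p - 1) = (n%:R - 4) / 2 - drift n p by rewrite /drift /half_dim; ring.
by rewrite Q4E.
Qed.

Lemma ltr_drift n p q : 1 < p -> 1 < q -> (drift n p < drift n q) = (p < q).
Proof.
move=> p1 q1; rewrite /drift ltrD2l ltrN2 ltr_pM2l// ltf_pV2 ?posrE; [|lra|lra].
by rewrite ltrD2r.
Qed.

Lemma ler_drift n p q : 1 < p -> 1 < q -> (drift n p <= drift n q) = (p <= q).
Proof. by move=> p1 q1; rewrite !leNgt ltr_drift. Qed.

(** Inverse of the increasing map [drift n] from [p > 1] onto [v < half_dim n]; it carries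
    thresholds in [u] to thresholds in [p]. *)
Definition power_of_drift n v : R := 1 + 4 / (half_dim n - v).

Lemma power_of_drift_gt1 n v : v < half_dim n -> 1 < power_of_drift n v.
Proof. by move=> va; rewrite ltrDl divr_gt0// subr_gt0. Qed.

Lemma power_of_driftK n v : v < half_dim n -> drift n (power_of_drift n v) = v.
Proof.
move=> va; rewrite /drift /power_of_drift; have : half_dim n - v != 0 by rewrite gt_eqF// subr_gt0.
move=> h; have -> : 1 + 4 / (half_dim n - v) - 1 = 4 / (half_dim n - v) by ring.
by field.
Qed.

Lemma half_dim_ge n : (13 <= n)%N -> 9 / 2 <= half_dim n :> R.
Proof.
move=> n13; have : 13 <= n%:R :> R by rewrite (ler_nat R 13).
by rewrite /half_dim; lra.
Qed.

Lemma eigen_poly_drift n p x : 1 < p -> (eigen_poly n p).[x] =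
  quartic (half_dim n) ((x + drift n p) ^+ 2) - shifted_source (half_dim n) (drift n p).
Proof.
move=> p1; rewrite /eigen_poly !(hornerD, hornerN, hornerC, horner_comp, hornerX).
rewrite source_drift//; congr (_ - _).
have -> : 4 / (p - 1) - x = (n%:R - 4) / 2 - (x + drift n p) by rewrite /drift /half_dim; ring.
by rewrite Q4E.
Qed.

(** The left endpoint has drift 0, and the inequality defining the critical power says that the
    resonance at weight 0 is negative, that is [drift n p < u1]. *)
Lemma critical_powerE n u1 : (13 <= n)%N -> 0 < u1 < half_dim n ->
  (forall u, 0 < u < half_dim n ->
     (0 <= resonance (half_dim n) 0 u) = (u1 <= u)) ->
  critical_power n = (power_of_drift n u1)%:E.
Proof.
move=> n13 /andP[u10 u1a] hu; rewrite /critical_power.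
have ha := half_dim_ge n13.
set a := half_dim n in u1a hu ha *.
set p0 := (n%:R + 4) / (n%:R - 4) : R.
have p0E : p0 = power_of_drift n 0.
  rewrite /p0 /power_of_drift /half_dim; field.
  by have := half_dim_ge n13; rewrite /half_dim => ?; rewrite gt_eqF//; lra.
have a0 : 0 < a by lra.
have p01 : 1 < p0 by rewrite p0E power_of_drift_gt1.
have Dp0 : drift n p0 = 0 by rewrite p0E power_of_driftK.
set p1 := power_of_drift n u1.
have p11 : 1 < p1 by exact: power_of_drift_gt1.
have Dp1 : drift n p1 = u1 by rewrite power_of_driftK.
have p0p1 : p0 < p1 by rewrite -(ltr_drift n)// Dp0 Dp1.
have key p : p0 < p -> ((Q4 n).[(n%:R - 4) / 2] < p * (Q4 n).[4 / (p - 1)]) = (p < p1).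
  move=> p0p; have p1' : 1 < p by lra.
  rewrite source_drift// -(ltr_drift n)// Dp1.
  have d0 : 0 < drift n p by rewrite -Dp0 ltr_drift.
  have da : drift n p < a by rewrite /drift ltrBlDr ltrDl divr_gt0//; lra.
  rewrite [RHS]ltNge -hu ?d0// -ltNge /resonance subr_lt0; congr (_ < _).
  by rewrite -[X in horner _ X]subr0 Q4E mul0r expr0n.
apply/le_anti/andP; split.
  apply: ge_ereal_sup => _ [q [p0q hq] <-]; rewrite lee_fin leNgt; apply/negP => p1q.
  by have := hq p1; rewrite p0p1 p1q => /(_ isT); rewrite key// ltxx.
apply: ereal_sup_ubound; exists p1 => //; split => // p /andP[p0p pp1].
by rewrite key.
Qed.

(** The bound [N.+1 * l3 < l2], valid for all these [p], stands for the convention that the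
    threshold after the last one is infinite. *)
Lemma parameters n : (13 <= n)%N -> exists (N : nat) (pk : nat -> R),
  [/\ (1 <= N)%N, (pk 1%N)%:E = critical_power n,
      (forall k, (1 <= k < N)%N -> pk k < pk k.+1) &
  forall p, (critical_power n <= p%:E)%E ->
    [/\ 1 < p, 0 < drift n p < half_dim n &
  exists l1 l2 l3 l4 : R,
  [/\ ordered_eigenvalues n p l1 l2 l3 l4,
     [/\ l1 + l4 = l2 + l3, (N.+1)%:R * l3 < l2 &
     forall x, (x - l1) * (x - l2) * (x - l3) * (x - l4) =
       quartic (half_dim n) ((x + drift n p) ^+ 2) - shifted_source (half_dim n) (drift n p)],
     (forall k, (1 <= k <= N)%N -> (l2 <= k%:R * l3) = (pk k <= p)) &
     (forall k, (1 <= k <= N)%N -> (l2 < k%:R * l3) = (pk k < p))]]].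
Proof.
move=> n13; have ha := half_dim_ge n13.
have [N [uk [N1 uka ukS ukP uN]]] := thresholds ha.
have /andP[u10 u1a] : 0 < uk 1%N < half_dim n by apply: uka; rewrite N1.
have crit : critical_power n = (power_of_drift n (uk 1%N))%:E.
  apply: critical_powerE; rewrite ?u10// => u u0.
  have N1' : (1 <= 1 <= N)%N by rewrite N1.
  by have [] := ukP 1%N u N1' u0; rewrite weight1.
have kgt1 k : (1 <= k <= N)%N -> 1 < power_of_drift n (uk k).
  by move=> /uka/andP[_ h]; exact: power_of_drift_gt1.
have kK k : (1 <= k <= N)%N -> drift n (power_of_drift n (uk k)) = uk k.
  by move=> /uka/andP[_ h]; exact: power_of_driftK.
exists N, (fun k => power_of_drift n (uk k)); split => //.
  move=> k kN; have kN1 : (1 <= k <= N)%N by lia.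
  have kN2 : (1 <= k.+1 <= N)%N by lia.
  by rewrite -(ltr_drift n) ?kgt1// !kK// ukS.
move=> p; rewrite crit lee_fin => pc.
have N1' : (1 <= 1 <= N)%N by rewrite N1.
have p1 : 1 < p by apply: lt_le_trans pc; exact: kgt1.
have dp1 : uk 1%N <= drift n p by rewrite -[leLHS]kK// ler_drift// kgt1.
have dp : 0 < drift n p < half_dim n.
  rewrite (lt_le_trans u10)//= /drift ltrBlDr ltrDl divr_gt0//; lra.
split => //.
have [|l1 [l2 [l3 [l4 [lo s14 s23 fac lk]]]]] := spectrum dp.
  by have [] := ukP 1%N _ N1' dp; rewrite weight1 => ->.
exists l1, l2, l3, l4; split.
- split=> //; apply: poly_ext => x; rewrite eigen_poly_drift// -fac.
  by rewrite !big_cons big_nil !(hornerM, hornerD, hornerN, hornerC, hornerX); ring.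
- split => //; rewrite ltNge; have [-> _] := lk N.+1 isT.
  by rewrite -ltNge uN.
- move=> k kN; have /andP[k1 _] := kN; have [-> _] := lk k k1.
  by have [-> _] := ukP k _ kN dp; rewrite -[RHS](ler_drift n) ?kgt1// kK.
- move=> k kN; have /andP[k1 _] := kN; have [_ ->] := lk k k1.
  by have [_ ->] := ukP k _ kN dp; rewrite -[RHS](ltr_drift n) ?kgt1// kK.
Qed.

End Exponents.

(** * From the radial equation to an autonomous one *)

Section Line.
Context {R : realType} {n : nat}.
Implicit Types (psi : 'rV[R]_n -> R) (x v : 'rV[R]_n).

Lemma difference_quotient_line psi x v (t : R) :
  (fun h : R => h^-1 *: ((psi \o shift (t *: v + x)) (h *: v) - psi (t *: v + x))) =
  (fun h : R => h^-1 *: (((fun s : R => psi (s *: v + x)) \o shift t) (h *: (1 : R))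
     - psi (t *: v + x))).
Proof.
apply/funext => h /=; congr (_ *: (psi _ - _)).
by rewrite addrA -scalerDl /GRing.scale /= mulr1.
Qed.

Lemma derivable_line psi x v (t : R) :
  derivable psi (t *: v + x) v <-> derivable (fun s : R => psi (s *: v + x)) t 1.
Proof. by rewrite /derivable difference_quotient_line. Qed.

Lemma derive_line psi x v (t : R) :
  'D_v psi (t *: v + x) = 'D_1 (fun s : R => psi (s *: v + x)) t.
Proof. by rewrite /derive difference_quotient_line. Qed.

Lemma derive_line0 psi x v d :
  is_derive (0 : R) (1 : R) (fun s : R => psi (s *: v + x)) d -> 'D_v psi x = d.
Proof.
move=> h; have := derive_line psi x v 0.
by rewrite scale0r add0r => ->; rewrite derive_val.
Qed.

End Line.

Section Radial.
Context {R : realType} {n : nat}.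
Implicit Types (psi : 'rV[R]_n -> R) (x : 'rV[R]_n) (i : 'I_n) (g : R -> R).

Lemma eucl_norm_sqr x : eucl_norm x ^+ 2 = \sum_(i < n) x ord0 i ^+ 2.
Proof. by rewrite sqr_sqrtr// sumr_ge0// => i _; rewrite sqr_ge0. Qed.

Lemma eucl_norm_line x i (h : R) :
  eucl_norm (h *: delta_mx ord0 i + x) =
  Num.sqrt (h ^+ 2 + (2 * x ord0 i) * h + eucl_norm x ^+ 2).
Proof.
rewrite eucl_norm_sqr /eucl_norm; congr Num.sqrt.
rewrite (bigD1 i)//= [in RHS](bigD1 i)//= addrA; congr (_ + _).
  by rewrite !mxE !eqxx /= mulr1; ring.
apply: eq_bigr => j ji; rewrite !mxE eqxx /= (negbTE ji) mulr0 add0r.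
by [].
Qed.

Lemma is_derive_eucl_norm x i : 0 < eucl_norm x ->
  is_derive (0 : R) (1 : R) (fun h : R => eucl_norm (h *: delta_mx ord0 i + x))
    (x ord0 i / eucl_norm x).
Proof.
move=> x0.
have -> : (fun h : R => eucl_norm (h *: delta_mx ord0 i + x)) =
    fun h => Num.sqrt (h ^+ 2 + (2 * x ord0 i) * h + eucl_norm x ^+ 2).
  by apply/funext => h; exact: eucl_norm_line.
have dQ : derives (fun h : R => h ^+ 2 + (2 * x ord0 i) * h + eucl_norm x ^+ 2)
    (fun h => 2 * h + 2 * x ord0 i).
  have := derivesD (derivesD (derivesM derives_id derives_id)
    (derivesZ (2 * x ord0 i) derives_id)) (derives_cst (eucl_norm x ^+ 2)).
  move=> H; refine (derives_eq H _) => s /=; ring.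
have Q0 : 0 ^+ 2 + 2 * x ord0 i * 0 + eucl_norm x ^+ 2 = eucl_norm x ^+ 2 :> R.
  by rewrite expr0n mulr0 !add0r.
have s0 : 0 < 0 ^+ 2 + 2 * x ord0 i * 0 + eucl_norm x ^+ 2 by rewrite Q0 exprn_gt0.
pose Q h : R := h ^+ 2 + 2 * x ord0 i * h + eucl_norm x ^+ 2.
refine (is_derive_eq (@is_derive1_comp R _ Q 0 _ _ (is_derive1_sqrt s0) (dQ 0)) _).
rewrite Q0.
by rewrite sqrtr_sqr gtr0_norm// mulr0 add0r; field; rewrite gt_eqF.
Qed.

Lemma near_eucl_norm_gt0 x i : 0 < eucl_norm x ->
  \forall h \near (0 : R), 0 < eucl_norm (h *: delta_mx ord0 i + x).
Proof.
move=> x0; have [/derivable1_diffP/differentiable_continuous d _] := is_derive_eucl_norm i x0.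
have e : eucl_norm (0 *: delta_mx ord0 i + x) = eucl_norm x by rewrite scale0r add0r.
have d' : eucl_norm (h *: delta_mx ord0 i + x) @[h --> (0 : R)] --> eucl_norm x.
  by rewrite -[in X in _ --> X]e; exact: d.
exact: (cvgr_gt _ d' _ x0).
Qed.

Lemma partial_radial psi g g1 :
  (forall y, 0 < eucl_norm y -> psi y = g (eucl_norm y)) ->
  (forall r : R, 0 < r -> is_derive r (1 : R) g (g1 r)) ->
  forall i x, 0 < eucl_norm x -> partial i psi x = g1 (eucl_norm x) * (x ord0 i / eucl_norm x).
Proof.
move=> pg gd i x x0; apply: derive_line0.
have H := is_derive_eucl_norm i x0.
have e0 : eucl_norm (0 *: delta_mx ord0 i + x) = eucl_norm x by rewrite scale0r add0r.
have := @is_derive1_comp R g (fun h : R => eucl_norm (h *: delta_mx ord0 i + x)) 0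
  (g1 (eucl_norm x)) _ _ H.
rewrite e0 => /(_ (gd _ x0)); apply: near_eq_is_derive.
near=> h; rewrite /= pg//.
by near: h; exact: near_eucl_norm_gt0.
Unshelve. all: by end_near. Qed.

(** Restricted to points off the origin, where the norm is differentiable; the logarithmic variable
    sees only [r > 0]. *)
Lemma laplacian_radial psi g g1 g2 :
  (forall y, 0 < eucl_norm y -> psi y = g (eucl_norm y)) ->
  (forall r : R, 0 < r -> is_derive r (1 : R) g (g1 r)) ->
  (forall r : R, 0 < r -> is_derive r (1 : R) g1 (g2 r)) ->
  forall x, 0 < eucl_norm x ->
  laplacian psi x = g2 (eucl_norm x) + (n%:R - 1) / eucl_norm x * g1 (eucl_norm x).
Proof.
move=> pg gd g1d x x0; set r := eucl_norm x.
have r0 : r != 0 by rewrite gt_eqF.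
have pp i : partial i (partial i psi) x =
    (g2 r - g1 r / r) / r ^+ 2 * x ord0 i ^+ 2 + g1 r / r.
  apply: derive_line0.
  have H := is_derive_eucl_norm i x0.
  have e0 : eucl_norm (0 *: delta_mx ord0 i + x) = r by rewrite scale0r add0r.
  have H1 := @is_derive1_comp R g1 (fun h : R => eucl_norm (h *: delta_mx ord0 i + x)) 0
    (g2 r) _ _ H.
  rewrite e0 in H1; have {}H1 := H1 (g1d _ x0).
  have ne : eucl_norm ((0 : R) *: delta_mx ord0 i + x) != 0 by rewrite e0.
  have H2 := @is_deriveV R (fun h : R => eucl_norm (h *: delta_mx ord0 i + x)) 0 _ 1 ne H.
  have H3 := derivesD derives_id (derives_cst (x ord0 i)) (0 : R).
  have H4 := is_deriveM H1 (is_deriveM H3 H2).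
  have := near_eq_is_derive _ (is_derive_eq H4 _); apply.
    near=> h; rewrite /= (partial_radial pg gd); last first.
      by near: h; exact: near_eucl_norm_gt0.
    by rewrite !mxE !eqxx /= mulr1.
  rewrite !fctE /= e0 add0r -/r /GRing.scale /=. field.
  exact: r0.
rewrite /laplacian (eq_bigr _ (fun i _ => pp i)) big_split /= -mulr_sumr -eucl_norm_sqr -/r.
rewrite sumr_const card_ord -mulr_natl; field.
exact: r0.
Unshelve. all: by end_near. Qed.

End Radial.

Lemma is_derive1M {R : realType} (f g : R -> R) (t a b : R) :
  is_derive t (1 : R) f a -> is_derive t (1 : R) g b ->
  is_derive t (1 : R) (fun y => f y * g y) (a * g t + f t * b).
Proof.
move=> fd gd; apply: (is_derive_eq (is_deriveM fd gd)).
by rewrite /GRing.scale /= addrC [g t * a]mulrC.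
Qed.

Lemma is_derive1V {R : realType} (t : R) : 0 < t ->
  is_derive t (1 : R) (fun y : R => y^-1) (- t ^- 2).
Proof.
move=> t0; have t0' : t != 0 by rewrite gt_eqF.
apply: (is_derive_eq (@is_deriveV R id t _ 1 t0' (is_derive_id _ _))).
by rewrite /GRing.scale /= mulr1.
Qed.

Section Profile.
Context {R : realType} {n : nat}.
Implicit Types (psi phi : 'rV[R]_n -> R) (x : 'rV[R]_n) (i : 'I_n).

Lemma Cclass_iter_partial k j psi i x : Cclass k psi -> (j < k)%N ->
  derivable (iter j (partial i) psi) x (delta_mx ord0 i).
Proof.
elim: j k psi => [|j IH] [|k] psi //= [_ h]; have [d c] := h i.
  by move=> _; exact: d.
by rewrite ltnS => jk; rewrite -iterS iterSr; apply: IH c jk.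
Qed.

(** [f] is arbitrary for [r < 0], so it is replaced by the restriction of [phi] to a coordinate
    axis. This is differentiable four times on the whole line, which will bound its first three
    derivatives as [r] tends to 0. *)
Lemma radial_profile (i : 'I_n) (p : R) phi (f : R -> R) :
  positive_radial_solution p phi f -> exists F : nat -> R -> R,
  [/\ (forall j, (j < 4)%N -> derives (F j) (F j.+1)),
      (forall r : R, 0 < r -> F 0%N r = f r), (forall r, 0 < F 0%N r) &
      (forall r : R, 0 < r -> F 4%N r + 2 * (n%:R - 1) / r * F 3%N r
         + (n%:R - 1) * (n%:R - 3) * (F 2%N r / r ^+ 2 - F 1%N r / r ^+ 3) = F 0%N r `^ p)].
Proof.
move=> [phi4 phi0 phif pde].
pose e : 'rV[R]_n := delta_mx ord0 i.
pose F j (r : R) := iter j (partial i) phi (r *: e + 0).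
have dF j : (j < 4)%N -> derives (F j) (F j.+1).
  move=> j4 r; rewrite /F iterS /partial derive_line.
  by apply: DeriveDef => //; apply/derivable_line; exact: Cclass_iter_partial phi4 j4.
have ne (r : R) : 0 < r -> eucl_norm (r *: e) = r.
  move=> r0; rewrite /eucl_norm (bigD1 i)//= big1 => [|k ki].
    by rewrite addr0 !mxE !eqxx mulr1 sqrtr_sqr gtr0_norm.
  by rewrite !mxE eqxx /= (negbTE ki) mulr0 expr0n.
have F0 (r : R) : 0 < r -> F 0%N r = f r by move=> r0; rewrite /F /= addr0 phif ne.
exists F; split => //; first by move=> r; exact: phi0.
move=> r r0.
have n1 : n%:R != 0 :> R by rewrite pnatr_eq0 -lt0n (leq_ltn_trans _ (ltn_ord i)).
pose c : R := n%:R - 1.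
have lap y : 0 < eucl_norm y ->
    laplacian phi y = F 2%N (eucl_norm y) + c / eucl_norm y * F 1%N (eucl_norm y).
  apply: (@laplacian_radial R n phi (F 0%N)) => [z z0|t _|t _].
  - by rewrite F0// phif.
  - exact: dF.
  - exact: dF.
pose g r : R := F 2%N r + c / r * F 1%N r.
pose g1 r : R := F 3%N r + c * (F 2%N r / r - F 1%N r / r ^+ 2).
pose g2 r : R := F 4%N r + c * (F 3%N r / r - 2 * F 2%N r / r ^+ 2 + 2 * F 1%N r / r ^+ 3).
have pF : phi (r *: e) = F 0%N r by rewrite /F addr0.
have Fd j t : (j < 4)%N -> is_derive t (1 : R) (F j) (F j.+1 t) by move=> /dF.
clearbody F.
have dg (t : R) : 0 < t -> is_derive t (1 : R) g (g1 t).
  move=> t0; have V := is_derive1M (is_derive_cst c t 1) (is_derive1V t0).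
  apply: (is_derive_eq (is_deriveD (Fd 2%N t isT) (is_derive1M V (Fd 1%N t isT)))).
  rewrite /g1 /cst /=; move: (F 3%N t) (F 2%N t) (F 1%N t) => x3 x2 x1.
  by field; rewrite gt_eqF.
have dg1 (t : R) : 0 < t -> is_derive t (1 : R) g1 (g2 t).
  move=> t0; have V := is_derive1V t0.
  have H := is_deriveD (Fd 3%N t isT) (is_derive1M (is_derive_cst c t 1)
    (is_deriveB (is_derive1M (Fd 2%N t isT) V)
      (is_derive1M (Fd 1%N t isT) (is_derive1M V V)))).
  have -> : g1 = fun y => F 3%N y + c * (F 2%N y * y^-1 - F 1%N y * (y^-1 * y^-1)).
    by apply/funext => y; rewrite /g1 expr2 invfM.
  apply: (is_derive_eq H); rewrite /g2 /cst /=.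
  move: (F 4%N t) (F 3%N t) (F 2%N t) (F 1%N t) => x4 x3 x2 x1.
  by field; rewrite gt_eqF.
have lap2 := laplacian_radial (psi := laplacian phi) (g := g) lap dg dg1.
have := pde (r *: e); rewrite lap2 ne// pF => <-.
rewrite /g2 /g1 /c; move: (F 4%N r) (F 3%N r) (F 2%N r) (F 1%N r) => x4 x3 x2 x1.
by field; rewrite gt_eqF.
Qed.

End Profile.

(* [w j] stands for the [j]-th derivative of [w 0]; [sub_deriv l] is [d/ds - l]. *)
Definition sub_deriv {R : realType} (l : R) (w : nat -> R -> R) : nat -> R -> R :=
  fun j s => w j.+1 s - l * w j s.

Definition jet {R : realType} (k : nat) (w : nat -> R -> R) : Prop :=
  forall j, (j < k)%N -> derives (w j) (w j.+1).

Definition bounded_left {R : realType} (g : R -> R) : Prop :=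
  exists M : R, forall s, s <= 0 -> `|g s| <= M.

Section EmdenFowler.
Context {R : realType}.
Implicit Types (w : nat -> R -> R) (g h : R -> R) (l a u p : R).

Lemma jet_sub_deriv k l w : jet k.+1 w -> jet k (sub_deriv l w).
Proof.
move=> jw j jk; apply: derivesB; first exact: jw.
by apply: derivesZ; apply: jw; exact: ltnW.
Qed.

Lemma sub_derivE l w k : jet k.+1 w ->
  derives (w 0%N) (fun s => l * w 0%N s + sub_deriv l w 0%N s).
Proof.
by move=> jw; refine (derives_eq (jw 0%N isT) _) => s; rewrite /sub_deriv; ring.
Qed.

Lemma bounded_leftD g h : bounded_left g -> bounded_left h ->
  bounded_left (fun s => g s + h s).
Proof.
move=> [M gM] [N hN]; exists (M + N) => s s0.
by rewrite (le_trans (ler_normD _ _))// lerD ?gM ?hN.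
Qed.

Lemma bounded_leftZ (c : R) g : bounded_left g -> bounded_left (fun s => c * g s).
Proof.
by move=> [M gM]; exists (`|c| * M) => s s0; rewrite normrM ler_wpM2l// gM.
Qed.

Lemma bounded_sub_deriv k l w : (forall j, (j <= k.+1)%N -> bounded_left (w j)) ->
  forall j, (j <= k)%N -> bounded_left (sub_deriv l w j).
Proof.
move=> bw j jk; have -> : sub_deriv l w j = fun s => w j.+1 s + - l * w j s.
  by apply/funext => s; rewrite /sub_deriv mulNr.
by apply: bounded_leftD; [exact: bw|apply/bounded_leftZ/bw/ltnW].
Qed.

(* [s -> -oo] is [r -> 0+], where the profile and its derivatives are bounded. *)
Lemma bounded_left_expR (F dF : R -> R) (mu : R) : 0 <= mu -> derives F dF ->
  bounded_left (fun s => expR (mu * s) * F (expR s)).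
Proof.
move=> mu0 dF'; have cF : {within `[(0 : R), 1], continuous F}.
  by apply: derivable_within_continuous => x _; have [] := dF' x.
have [c1 _ h1] := EVT_max ler01 cF; have [c2 _ h2] := EVT_min ler01 cF.
exists (`|F c1| + `|F c2|) => s s0.
have e1 : expR s <= 1 by rewrite -[leRHS]expR0 ler_expR.
have es : expR s \in `[(0 : R), 1] by rewrite in_itv /= expR_ge0.
have e2 : expR (mu * s) <= 1 by rewrite -[leRHS]expR0 ler_expR mulr_ge0_le0.
rewrite normrM ger0_norm ?expR_ge0//.
apply: (@le_trans _ _ (1 * `|F (expR s)|)); first by rewrite ler_wpM2r.
rewrite mul1r ler_norml; have := h1 _ es; have := h2 _ es.
have := ler_norm (F c1); have := ler_norm (- F c2); rewrite normrN.
have := normr_ge0 (F c1); have := normr_ge0 (F c2).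
by move=> *; apply/andP; split; lra.
Qed.

(** [quartic a ((D + u)^2)] expanded in powers of [D = d/ds], that is [Q4 (m - D)]. *)
Definition radial_op a u w s : R := w 4%N s + 4 * u * w 3%N s
  + (6 * u ^+ 2 - (a ^+ 2 + (a + 2) ^+ 2)) * w 2%N s
  + (4 * u ^+ 3 - 2 * u * (a ^+ 2 + (a + 2) ^+ 2)) * w 1%N s
  + quartic a (u ^+ 2) * w 0%N s.

Lemma sub_deriv4 a u (K r1 r2 r3 r4 : R) w s :
  (forall x, (x - r1) * (x - r2) * (x - r3) * (x - r4) = quartic a ((x + u) ^+ 2) - K) ->
  sub_deriv r1 (sub_deriv r2 (sub_deriv r3 (sub_deriv r4 w))) 0%N s =
  radial_op a u w s - K * w 0%N s.
Proof.
(* Five values determine a quartic: the elementary symmetric functions of the roots follow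
   linearly. *)
move=> h; have := h 0; have := h 1; have := h (-1); have := h 2; have := h (-2).
rewrite /quartic => h1 h2 h3 h4 h5.
pose e1 := r1 + r2 + r3 + r4.
pose e2 := r1 * r2 + r1 * r3 + r1 * r4 + r2 * r3 + r2 * r4 + r3 * r4.
pose e3 := r1 * r2 * r3 + r1 * r2 * r4 + r1 * r3 * r4 + r2 * r3 * r4.
pose e4 := r1 * r2 * r3 * r4.
have E1 : e1 = - 4 * u by rewrite /e1; lra.
have E2 : e2 = 6 * u ^+ 2 - (a ^+ 2 + (a + 2) ^+ 2) by rewrite /e2; lra.
have E3 : e3 = - (4 * u ^+ 3 - 2 * u * (a ^+ 2 + (a + 2) ^+ 2)) by rewrite /e3; lra.
have E4 : e4 = quartic a (u ^+ 2) - K by rewrite /e4 /quartic; lra.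
transitivity (w 4%N s - e1 * w 3%N s + e2 * w 2%N s - e3 * w 1%N s + e4 * w 0%N s).
  by rewrite /sub_deriv /e1 /e2 /e3 /e4; ring.
by rewrite E1 E2 E3 E4 /radial_op; ring.
Qed.

Lemma emden_fowler n p (phi : 'rV[R]_n -> R) (f : R -> R) : (13 <= n)%N -> 1 < p ->
  positive_radial_solution p phi f -> exists w : nat -> R -> R,
  [/\ jet 4 w, (forall j, (j <= 3)%N -> bounded_left (w j)),
      (forall s, w 0%N s = expR (4 / (p - 1) * s) * f (expR s)),
      (forall s, 0 < w 0%N s) &
      (forall s, radial_op (half_dim n) (drift n p) w s = w 0%N s `^ p)].
Proof.
move=> n13 p1 sol; have n0 : (0 < n)%N by lia.
have [F [dF Ff F0 Fode]] := radial_profile (Ordinal n0) sol.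
pose m := 4 / (p - 1); have m0 : 0 < m by rewrite divr_gt0//; lra.
pose G j s := expR ((m + j%:R) * s) * F j (expR s).
have dG j : (j < 4)%N -> derives (G j) (fun s => (m + j%:R) * G j s + G j.+1 s).
  move=> j4; have dE : derives (fun s : R => expR s) (fun s => expR s).
    by move=> s; exact: is_derive_expR.
  refine (derives_eq (derivesM (derives_expR (m + j%:R))
     (derives_comp (fun s => dF j j4 (expR s)) dE)) _) => s.
  rewrite /G -natr1 !mulrDl mul1r !expRD; ring.
have bG j : (j < 4)%N -> bounded_left (G j).
  move=> j4; apply: (bounded_left_expR _ (dF j j4)).
  by rewrite addr_ge0// ltW.
(* Successive derivatives of [G 0], from the rule [(G j)' = (m + j) G j + G (j + 1)]. *)
pose w1 s := m * G 0%N s + G 1%N s.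
pose w2 s := m ^+ 2 * G 0%N s + ((2 * m + 1) * G 1%N s + G 2%N s).
pose w3 s := m ^+ 3 * G 0%N s + ((3 * m ^+ 2 + 3 * m + 1) * G 1%N s +
  ((3 * m + 3) * G 2%N s + G 3%N s)).
pose w4 s := m ^+ 4 * G 0%N s + ((m ^+ 3 + (3 * m ^+ 2 + 3 * m + 1) * (m + 1)) * G 1%N s +
  (((3 * m ^+ 2 + 3 * m + 1) + (3 * m + 3) * (m + 2)) * G 2%N s +
  (((3 * m + 3) + (m + 3)) * G 3%N s + G 4%N s))).
have dG0 := dG 0%N isT; have dG1 := dG 1%N isT.
have dG2 := dG 2%N isT; have dG3 := dG 3%N isT.
have bG0 := bG 0%N isT; have bG1 := bG 1%N isT.
have bG2 := bG 2%N isT; have bG3 := bG 3%N isT.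
exists (fun j => match j with 0 => G 0 | 1 => w1 | 2 => w2 | 3 => w3 | _ => w4 end)%N.
have ep s : 0 < expR s :> R by exact: expR_gt0.
split.
- case=> [|[|[|[|//]]]] _.
  + by refine (derives_eq dG0 _) => s; rewrite /w1; ring.
  + by refine (derives_eq (derivesD (derivesZ m dG0) dG1) _) => s; rewrite /w2; ring.
  + refine (derives_eq (derivesD (derivesZ _ dG0) (derivesD (derivesZ _ dG1) dG2)) _) => s.
    by rewrite /w3; ring.
  + refine (derives_eq (derivesD (derivesZ _ dG0) (derivesD (derivesZ _ dG1)
      (derivesD (derivesZ _ dG2) dG3))) _) => s.
    by rewrite /w4; ring.
- case=> [|[|[|[|//]]]] _ //.
  + by apply: bounded_leftD => //; exact: bounded_leftZ.
  + apply: bounded_leftD; first exact: bounded_leftZ.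
    by apply: bounded_leftD => //; exact: bounded_leftZ.
  + apply: bounded_leftD; first exact: bounded_leftZ.
    apply: bounded_leftD; first exact: bounded_leftZ.
    by apply: bounded_leftD => //; exact: bounded_leftZ.
- by move=> s; rewrite /G addr0 Ff.
- by move=> s; rewrite mulr_gt0 ?expR_gt0.
move=> s; set r := expR s.
have r0 : 0 < r by exact: expR_gt0.
have rn0 : r != 0 by rewrite gt_eqF.
have GE j : G j s = expR (m * s) * r ^+ j * F j r.
  by rewrite /G mulrDl expRD expRM_natl.
have -> : G 0%N s `^ p = expR (m * s) * r ^+ 4 * F 0%N r `^ p.
  rewrite GE expr0 mulr1 powRM ?expR_ge0//; last exact: ltW.
  congr (_ * _); rewrite /powR gt_eqF ?expR_gt0// expRK.
  have -> : p * (m * s) = m * s + 4%:R * s.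
    by rewrite /m; field; rewrite gt_eqF//; lra.
  by rewrite expRD expRM_natl.
rewrite -Fode// /radial_op /w1 /w2 /w3 /w4 !GE /quartic.
have -> : drift n p = half_dim n - m by [].
have -> : n%:R = 2 * half_dim n + 4 :> R by rewrite /half_dim; field.
by field.
Qed.

End EmdenFowler.

(** * Convergence to the singular solution *)

Section Convergence.
Context {R : realType}.
Variables (a u p : R) (w : nat -> R -> R).
Hypotheses (p1 : 1 < p) (u0 : 0 < u < a).
Hypothesis source : p * quartic a (u ^+ 2) = shifted_source a u.
Hypotheses (jw : jet 4 w) (bw : forall j, (j <= 3)%N -> bounded_left (w j)).
Hypothesis w0 : forall s, 0 < w 0%N s.
Hypothesis ode : forall s, radial_op a u w s = w 0%N s `^ p.

Let q := quartic a (u ^+ 2).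
Let L := q `^ (p - 1)^-1.

Let p10 : 0 < p - 1. Proof. by rewrite subr_gt0. Qed.

Let q0 : 0 < q.
Proof.
have [? ?] := andP u0; have : u ^+ 2 < a ^+ 2 by rewrite ltrXn2r// ltW.
by move=> h; rewrite /q /quartic mulr_gt0//; nra.
Qed.

Let L0 : 0 < L. Proof. exact: powR_gt0. Qed.

Let Lp1 : L `^ (p - 1) = q.
Proof. by rewrite -powRrM mulVf ?gt_eqF// powRr1// ltW. Qed.

Let Lp : L `^ p = q * L. Proof. by rewrite -powR_pred// Lp1. Qed.

Definition shift_jet (L : R) (w : nat -> R -> R) : nat -> R -> R :=
  fun j s => if j is 0 then w 0%N s - L else w j s.

Let wY := shift_jet L w.

Let jY : jet 4 wY.
Proof.
case=> [|j] j4; last exact: jw.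
by refine (derives_eq (derivesB (@jw 0%N isT) (derives_cst L)) _) => s; rewrite subr0.
Qed.

Let bY j : (j <= 3)%N -> bounded_left (wY j).
Proof.
case: j => [|j] j4; last exact: bw.
apply: (bounded_leftD (h := fun=> - L)); first exact: bw.
by exists `|- L| => s _.
Qed.

Let nonneg (l : R) (v : nat -> R -> R) (F : R -> R) : l < 0 -> jet 1 v -> bounded_left (v 0%N) ->
  (forall s, sub_deriv l v 0%N s = F s) -> (forall s, 0 <= F s) -> forall s, 0 <= v 0%N s.
Proof.
move=> l0 jv [M bv] vF F0.
apply: (nonneg_from_ninfty (l := l) (v := F) (M := M) (s0 := 0)) => //.
by refine (derives_eq (sub_derivE l jv) _) => s; rewrite vF.
Qed.

Section BelowSingular.
Variables (l1 l2 l3 l4 : R).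
Hypotheses (l12 : l1 < l2) (l23 : l2 <= l3) (l30 : l3 < 0) (l40 : 0 < l4).
Hypothesis fac : forall x, (x - l1) * (x - l2) * (x - l3) * (x - l4) =
  quartic a ((x + u) ^+ 2) - shifted_source a u.

Let v1 := sub_deriv l4 wY.
Let v2 := sub_deriv l3 v1.
Let v3 := sub_deriv l2 v2.

Lemma linearized_ode s : sub_deriv l1 v3 0%N s = powR_rem L p (wY 0%N s).
Proof.
rewrite /v3 /v2 /v1 (sub_deriv4 (a := a) (u := u) (K := shifted_source a u))//.
have -> : radial_op a u wY s = radial_op a u w s - q * L.
  by rewrite /radial_op /wY /= /q; ring.
rewrite ode /powR_rem /wY /=.
have -> : L + (w 0%N s - L) = w 0%N s by ring.
by rewrite Lp Lp1 -source -/q; ring.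
Qed.

Let j1 : jet 3 v1. Proof. exact: jet_sub_deriv. Qed.
Let j2 : jet 2 v2. Proof. exact: jet_sub_deriv. Qed.
Let j3 : jet 1 v3. Proof. exact: jet_sub_deriv. Qed.
Let b1 j : (j <= 2)%N -> bounded_left (v1 j). Proof. exact: bounded_sub_deriv. Qed.
Let b2 j : (j <= 1)%N -> bounded_left (v2 j). Proof. exact: bounded_sub_deriv. Qed.
Let b3 j : (j <= 0)%N -> bounded_left (v3 j). Proof. exact: bounded_sub_deriv. Qed.

Let rem0 s : 0 <= powR_rem L p (wY 0%N s).
Proof. by apply: powR_rem_ge0 => //; rewrite addrC subrK. Qed.

Let v30 s : 0 <= v3 0%N s.
Proof.
have l10 : l1 < 0 by move: l12 l23 l30; lra.
exact: (nonneg l10 j3 (b3 (leqnn _)) linearized_ode rem0).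
Qed.

Let v20 s : 0 <= v2 0%N s.
Proof.
have l20 : l2 < 0 by move: l23 l30; lra.
apply: (@nonneg l2 v2 (v3 0%N)) => //; last exact: b2.
by move=> j j1'; apply: j2; exact: (leq_trans j1').
Qed.

Let v10 s : 0 <= v1 0%N s.
Proof.
apply: (@nonneg l3 v1 (v2 0%N)) => //; last exact: b1.
by move=> j j1'; apply: j1; exact: (leq_trans j1').
Qed.

Let d0 : derives (wY 0%N) (fun s => l4 * wY 0%N s + v1 0%N s).
Proof. exact: sub_derivE jY. Qed.
Let d1 : derives (v1 0%N) (fun s => l3 * v1 0%N s + v2 0%N s).
Proof. exact: sub_derivE j1. Qed.
Let d2 : derives (v2 0%N) (fun s => l2 * v2 0%N s + v3 0%N s).
Proof. exact: sub_derivE j2. Qed.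
Let d3 : derives (v3 0%N) (fun s => l1 * v3 0%N s + powR_rem L p (wY 0%N s)).
Proof.
by refine (derives_eq (sub_derivE l1 j3) _) => s; rewrite linearized_ode.
Qed.

Lemma le_singular s : w 0%N s <= L.
Proof.
have [ys hys] := powR_rem_superlinear L0 p1.
rewrite -subr_le0; have half0 : (0 : R) < 2^-1 by rewrite invr_gt0.
by apply: (blow_up (ys := ys) l40 p1 half0 d0 d1 d2 d3) => // t /hys.
Qed.

(** [Q4 (m - x) - Q4 (m)] has the roots [0], [- 2 u] and [- u -+ mu]. The factors with negative
    roots are applied last, so that they can be inverted from -oo first; the root [- u + mu] is
    positive. *)
Let mu := Num.sqrt (a ^+ 2 + (a + 2) ^+ 2 - u ^+ 2).
Let z1 := sub_deriv 0 w.
Let z2 := sub_deriv (- u + mu) z1.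
Let z3 := sub_deriv (- 2 * u) z2.

Let mu_gt : u < mu.
Proof.
have [? ?] := andP u0; have u2 : u ^+ 2 < a ^+ 2 by rewrite ltrXn2r// ltW.
rewrite -[ltLHS]ger0_norm; last lra.
by rewrite -sqrtr_sqr ltr_sqrt; nra.
Qed.

Lemma subsingular_ode s :
  sub_deriv (- u - mu) z3 0%N s = w 0%N s * (w 0%N s `^ (p - 1) - q).
Proof.
have m2 : mu ^+ 2 = a ^+ 2 + (a + 2) ^+ 2 - u ^+ 2.
  rewrite sqr_sqrtr//; have [? ?] := andP u0.
  by have : u ^+ 2 < a ^+ 2; [rewrite ltrXn2r// ltW|nra].
rewrite /z3 /z2 /z1 (sub_deriv4 (a := a) (u := u) (K := q)).
  by rewrite ode -powR_pred//; ring.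
move=> x; rewrite subr0 /q /quartic.
have -> : (x - (- u - mu)) * (x - -2 * u) * (x - (- u + mu)) * x =
  ((x + u) ^+ 2 - mu ^+ 2) * ((x + u) ^+ 2 - u ^+ 2) by ring.
by rewrite m2; ring.
Qed.

Let F0 s : w 0%N s * (w 0%N s `^ (p - 1) - q) <= 0.
Proof.
rewrite pmulr_rle0// subr_le0 -Lp1 ge0_ler_powR ?nnegrE ?le_singular//; exact: ltW.
Qed.

Let jz1 : jet 3 z1. Proof. exact: jet_sub_deriv. Qed.
Let jz2 : jet 2 z2. Proof. exact: jet_sub_deriv. Qed.
Let jz3 : jet 1 z3. Proof. exact: jet_sub_deriv. Qed.
Let bz1 j : (j <= 2)%N -> bounded_left (z1 j). Proof. exact: bounded_sub_deriv. Qed.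
Let bz2 j : (j <= 1)%N -> bounded_left (z2 j). Proof. exact: bounded_sub_deriv. Qed.
Let bz3 j : (j <= 0)%N -> bounded_left (z3 j). Proof. exact: bounded_sub_deriv. Qed.

Let nonpos (l : R) (v : nat -> R -> R) (F : R -> R) : l < 0 -> jet 1 v -> bounded_left (v 0%N) ->
  (forall s, sub_deriv l v 0%N s = F s) -> (forall s, F s <= 0) -> forall s, v 0%N s <= 0.
Proof.
move=> l0 jv bv vF F0' s; rewrite -oppr_ge0.
apply: (@nonneg l (fun j s => - v j s) (fun s => - F s)) => //.
- by move=> j j1'; apply: derivesN; exact: jv.
- have -> : (fun s => - v 0%N s) = fun s => -1 * v 0%N s.
    by apply/funext => t; rewrite mulN1r.
  exact: bounded_leftZ.
- by move=> t; rewrite -vF /sub_deriv; ring.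
- by move=> t; rewrite oppr_ge0.
Qed.

Let z30 s : z3 0%N s <= 0.
Proof.
have l0 : - u - mu < 0 by have [? ?] := andP u0; have := mu_gt; lra.
exact: (nonpos l0 jz3 (bz3 (leqnn _)) subsingular_ode F0).
Qed.

Let z20 s : z2 0%N s <= 0.
Proof.
apply: (@nonpos (- 2 * u) z2 (z3 0%N)) => //; [have [? ?] := andP u0; lra| |exact: bz2].
by move=> j j1'; apply: jz2; exact: (leq_trans j1').
Qed.

Let dw0 : derives (w 0%N) (w 1%N). Proof. exact: jw. Qed.
Let dw1 : derives (w 1%N) (fun s => (- u + mu) * w 1%N s + z2 0%N s).
Proof.
by refine (derives_eq (@jw 1%N isT) _) => s; rewrite /z2 /z1 /sub_deriv; ring.
Qed.

Let mu0 : 0 < - u + mu. Proof. by have := mu_gt; lra. Qed.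

Lemma profile_nondecreasing s : 0 <= w 1%N s.
Proof. exact: (derives_nonneg_of_pos mu0 dw0 dw1). Qed.

(** If [w] stayed below [L - e], its monotonicity would keep the forcing [w (w ^ (p - 1) - q)] below
    a negative constant for [s >= 0], which [no_uniform_drift] excludes. *)
Lemma cvg_singular (e : R) : 0 < e ->
  exists s0, forall s, s0 <= s -> `|wY 0%N s| <= e.
Proof.
move=> e0; have [[s0 hs0]|no] := pselect (exists s0, L - e < w 0%N s0).
  exists s0 => s ss; rewrite ler0_norm; last by rewrite subr_le0 le_singular.
  have := derives_le dw0 ss (fun t _ => profile_nondecreasing t).
  by rewrite /wY /=; lra.
exfalso.
have small s : w 0%N s <= L - e by rewrite leNgt; apply/negP => h; apply: no; exists s.
have Le0 : 0 < L - e by apply: lt_le_trans (w0 0) (small 0).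
pose c := w 0%N 0 * (q - (L - e) `^ (p - 1)).
have c0 : 0 < c.
  rewrite mulr_gt0// subr_gt0 -Lp1 gt0_ltr_powR ?nnegrE//; [exact: ltW|exact: ltW|lra].
apply: (no_uniform_drift (mu1 := - u - mu) (mu2 := -2 * u) (L := L) (c := c) (s0 := 0)
  (F := fun s => w 0%N s * (w 0%N s `^ (p - 1) - q)) mu0 dw0 dw1 (sub_derivE _ jz2)) => //.
- by refine (derives_eq (sub_derivE (- u - mu) jz3) _) => s; rewrite subsingular_ode.
- exact: le_singular.
- exact: profile_nondecreasing.
move=> s s0; have m := derives_le dw0 s0 (fun t _ => profile_nondecreasing t).
have h : w 0%N s `^ (p - 1) <= (L - e) `^ (p - 1).
  by rewrite ge0_ler_powR ?nnegrE//; exact: ltW.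
have h' : 0 < q - (L - e) `^ (p - 1) by move: c0; rewrite /c pmulr_rgt0.
have := ler_pM (ltW (w0 0)) (ltW h') m (lexx _).
have : w 0%N s * (w 0%N s `^ (p - 1) - q) <= w 0%N s * ((L - e) `^ (p - 1) - q).
  by rewrite ler_pM2l// lerD2r.
by rewrite /c; lra.
Qed.

Lemma approach_singular : exists (L : R) (y y1 y2 y3 : R -> R),
  [/\ 0 < L /\ (forall s, w 0%N s = L + y s),
      derives y (fun s => l4 * y s + y1 s) /\ derives y1 (fun s => l3 * y1 s + y2 s),
      derives y2 (fun s => l2 * y2 s + y3 s) /\
      derives y3 (fun s => l1 * y3 s + powR_rem L p (y s)) &
      forall d, 0 < d -> exists C s0, forall s, s0 <= s -> `|y s| <= C * expR ((l3 + d) * s)].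
Proof.
exists L, (wY 0%N), (v1 0%N), (v2 0%N), (v3 0%N).
split => //; first by split => // s; rewrite /wY /= addrC subrK.
move=> d dpos; have y0 s : wY 0%N s <= 0 by rewrite subr_le0 le_singular.
have yv s : `|wY 0%N s| <= v1 0%N s / l4.
  rewrite ler0_norm// ler_pdivlMr// /v1 /sub_deriv /wY /=.
  by have := profile_nondecreasing s; lra.
have l13 : l1 < l3 := lt_le_trans l12 l23.
have [|C [s0 hC]] := chain_decay l13 l23 dpos d1 d2 d3 v10 v20 v30.
  move=> e e0; have [C [C0 hC]] := powR_rem_taylor p 0 L0.
  (* [L / 2] is the range of the Taylor bound; the other term gives [C |Y| <= e l4], so the
     remainder is at most [e l4 |Y| <= e v1]. *)
  pose t := Num.min (L / 2) (e * l4 / (C + 1)).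
  have C1 : 0 < C + 1 by lra.
  have t0 : 0 < t by rewrite lt_min divr_gt0//= divr_gt0// mulr_gt0.
  have [s0 hs0] := cvg_singular t0; exists s0 => s ss.
  have ht := hs0 s ss; have := hC (wY 0%N s).
  rewrite big_geq// subr0 => /(_ (le_trans ht _)) => h.
  have {}h : `|powR_rem L p (wY 0%N s)| <= C * `|wY 0%N s| ^+ 2.
    by apply: h; rewrite ge_min lexx.
  apply: le_trans (ler_norm _) _; apply: le_trans h _.
  apply: (@le_trans _ _ (e * l4 * `|wY 0%N s|)).
    rewrite expr2 mulrA ler_wpM2r//.
    apply: (@le_trans _ _ ((C + 1) * t)); first by apply: ler_pM => //; lra.
    by rewrite mulrC -ler_pdivlMr// ge_min lexx orbT.
  by rewrite -mulrA (ler_wpM2l (ltW e0))// mulrC -ler_pdivlMr.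
exists (C / l4), s0 => s ss; apply: le_trans (yv s) _.
by rewrite [leRHS]mulrAC ler_pM2r ?invr_gt0// hC.
Qed.

End BelowSingular.
End Convergence.

(** * The expansions *)

Definition multiples {R : realType} (l : R) (m n : nat) (k : nat) (mu : R) : Prop :=
  k = 0%N /\ exists2 j, (m <= j < n)%N & mu = j%:R * l.

Section Expansion.
Context {R : realType}.
Variables (l1 l2 l3 l4 L p : R) (y y1 y2 y3 : R -> R).
Hypotheses (l12 : l1 < l2) (l23 : l2 <= l3) (l30 : l3 < 0) (l40 : 0 < l4).
Hypothesis l14 : l1 + l4 = l2 + l3.
Hypothesis L0 : 0 < L.
Hypotheses (d0 : derives y (fun s => l4 * y s + y1 s))
  (d1 : derives y1 (fun s => l3 * y1 s + y2 s))
  (d2 : derives y2 (fun s => l2 * y2 s + y3 s))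
  (d3 : derives y3 (fun s => l1 * y3 s + powR_rem L p (y s))).
Hypothesis decay : forall d, 0 < d ->
  exists C s0, forall s, s0 <= s -> `|y s| <= C * expR ((l3 + d) * s).

Let h s := powR_rem L p (y s).

Lemma decay_bO d : 0 < d -> bO y 0 (l3 + d).
Proof.
move=> dpos; have [C [s0 hC]] := decay dpos.
exists `|C|, (Num.max 1 s0); split => //; first by rewrite le_max lexx.
move=> s; rewrite ge_max => /andP[_ /hC hs]; apply: le_trans hs _.
by rewrite /ep expr0 mul1r ler_wpM2r ?expR_ge0// ler_norm.
Qed.

Let yO : bO y 0 (l3 / 2).
Proof.
have d : 0 < - l3 / 2 by move: l30; lra.
by have := decay_bO d; congr (bO _ _ _); field.
Qed.

Lemma y_small (e : R) : 0 < e -> exists s0, forall s, s0 <= s -> `|y s| <= e.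
Proof.
move=> e0; have [C [s0 [C0 s01 hC]]] := yO.
pose t := C / e * (- (2 / l3)).
exists (Num.max s0 t) => s; rewrite ge_max => /andP[ss ts].
apply: le_trans (hC _ ss) _; rewrite /ep expr0 mul1r.
have : C / e <= expR (- (l3 / 2 * s)).
  apply: (@le_trans _ _ (- (l3 / 2 * s))); last by have := expR_ge1Dx (- (l3 / 2 * s)); lra.
  have : - (l3 / 2) * t <= - (l3 / 2) * s by rewrite ler_pM2l//; move: l30; lra.
  have -> : - (l3 / 2) * t = C / e.
    by rewrite /t; field; rewrite gt_eqF//= lt_eqF.
  lra.
rewrite expRN -[_ / _ <= _]/(C / e <= _) ler_pdivrMr// mulrC ler_pdivlMr ?expR_gt0//.
Qed.

Lemma bOX (v : R -> R) (b : R) j : bO v 0 b -> bO (fun s => v s ^+ j) 0 (j%:R * b).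
Proof.
move=> vb; elim: j => [|j IH].
  exists 1, 1; split => // s _; rewrite expr0 /ep expr0 mul1r mul0r mul0r expR0.
  by rewrite normr1 mulr1.
have -> : j.+1%:R * b = b + j%:R * b by rewrite -natr1; ring.
have -> : (fun s => v s ^+ j.+1) = fun s => v s * v s ^+ j.
  by apply/funext => s; rewrite exprS.
exact: (bOM vb IH).
Qed.

Lemma rem_bO M b : bO y 0 b ->
  bO (fun s => h s - \sum_(2 <= j < M.+2) powR_coef L p j * y s ^+ j) 0 (M.+2%:R * b).
Proof.
move=> yb; have [C [C0 hC]] := powR_rem_taylor p M L0.
have [|s0 hs0] := @y_small (L / 2); first by rewrite divr_gt0.
have [D [t0 [D0 t01 hD]]] := bOX M.+2 yb.
exists (C * D), (Num.max s0 t0); split; [exact: mulr_ge0|by rewrite le_max t01 orbT|].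
move=> s; rewrite ge_max => /andP[/hs0 ss /hD ts].
apply: le_trans (hC _ ss) _; rewrite -mulrA ler_wpM2l//.
by rewrite -normrX.
Qed.

Lemma asym_sum B q be (m n : nat) (c : nat -> R) (v : nat -> R -> R) :
  (forall j, (m <= j < n)%N -> asym B q be (v j)) ->
  asym B q be (fun s => \sum_(m <= j < n) c j * v j s).
Proof.
elim: n => [|n IH] vB.
  apply/asym_O/(bO_eq _ (bO0 q be)) => s; first by rewrite big_geq.
have [mn|nm] := leqP m n; last first.
  by apply/asym_O/(bO_eq _ (bO0 q be)) => s; rewrite big_geq.
apply: (asym_eq (u := fun s => \sum_(m <= j < n) c j * v j s + c n * v n s)) => [s|].
  by rewrite big_nat_recr.
apply: asymD; last by apply/asymZ/vB; rewrite mn ltnSn.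
by apply: IH => j /andP[mj jn]; apply: vB; rewrite mj ltnW.
Qed.

Lemma natl_lt (i j : nat) : (i < j)%N -> j%:R * l3 < i%:R * l3.
Proof. by move=> ij; rewrite ltr_nM2r// ltr_nat. Qed.

Lemma natl_le (i j : nat) : (i <= j)%N -> j%:R * l3 <= i%:R * l3.
Proof. by move=> ij; rewrite ler_nM2r// ler_nat. Qed.

Lemma negl_lt k (mu : R) q be : mu < be -> negl k mu q be.
Proof. by left. Qed.

(** Each error term of a product comes with another factor of size at most [exp (l3 s)], which
    improves the error from [be] to [be + l3]. Multiples of [l3] from [d.+1] on are then
    absorbed. *)
Lemma powers_expand d q be j : asym (multiples l3 1 d) q be y ->
  d%:R * l3 <= be -> be < l3 ->
  asym (multiples l3 2 d.+1) q (be + l3) (fun s => y s ^+ j.+2).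
Proof.
move=> yB dbe bel.
have dbe1 : d.+1%:R * l3 <= be + l3 by rewrite -natr1 mulrDl mul1r lerD2r.
have absorb a b : (2 <= a + b)%N ->
    multiples l3 2 d.+1 (0 + 0) (a%:R * l3 + b%:R * l3) \/
    negl (0 + 0) (a%:R * l3 + b%:R * l3) q (be + l3).
  move=> ab; rewrite -mulrDl -natrD; have [abd|dab] := ltnP (a + b) d.+1.
    by left; split => //; exists (a + b)%N => //; rewrite ab.
  right; have : (a + b)%:R * l3 <= be + l3 by apply: le_trans dbe1; exact: natl_le.
  by rewrite le_eqVlt => /predU1P[->|]; [right|left].
have err a q' : (1 <= a)%N -> (q' <= q)%N -> negl q' (a%:R * l3 + be) q (be + l3).
  move=> a1 qq; have : a%:R * l3 + be <= be + l3.
    by rewrite addrC lerD2l; have := natl_le a1; rewrite mul1r.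
  by rewrite le_eqVlt => /predU1P[->|]; [right|left].
elim: j => [|j IH].
  apply: (asym_eq (u := fun s => y s * y s)) => [s|]; first by rewrite expr2.
  apply: (asymM _ _ _ _ yB yB).
  - move=> _ _ _ _ [-> [a /andP[a1 ad] ->]] [-> [b /andP[b1 bd] ->]].
    by apply: absorb; lia.
  - by move=> _ _ [-> [a /andP[a1 ad] ->]]; apply: err.
  - move=> _ _ [-> [a /andP[a1 ad] ->]]; rewrite addrC; apply: err => //.
    by rewrite addn0.
  - by apply: negl_lt; rewrite ltrD2l.
apply: (asym_eq (u := fun s => y s ^+ j.+2 * y s)) => [s|]; first by rewrite -exprSr.
apply: (asymM _ _ _ _ IH yB).
- move=> _ _ _ _ [-> [a /andP[a1 ad] ->]] [-> [b /andP[b1 bd] ->]].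
  by apply: absorb; lia.
- by move=> _ _ [-> [a /andP[a1 ad] ->]]; apply: err => //; exact: ltnW.
- move=> _ _ [-> [a /andP[a1 ad] ->]]; apply: negl_lt.
  rewrite -addrA ltrD2l; have := natl_le a1; rewrite mul1r; move: l30; lra.
- by apply: negl_lt; move: bel l30; lra.
Qed.

Lemma rem_expand d q be : asym (multiples l3 1 d) q be y ->
  d%:R * l3 <= be -> be < l3 -> asym (multiples l3 2 d.+1) q (be + l3) h.
Proof.
move=> yB dbe bel.
(* The Taylor order is large enough for the crude rate [l3 / 2] of [y] to push the remainder below
   [be + l3]. *)
pose M := Num.bound `|(be + l3) / (l3 / 2)|.
have MB : M.+2%:R * (l3 / 2) < be + l3.
  rewrite -ltr_ndivrMr; last by rewrite pmulr_llt0.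
  apply: le_lt_trans (ler_norm _) _; apply: lt_le_trans (archi_boundP _) _ => //.
  by rewrite ler_nat -/M; lia.
have hO := bO_weaken (negl_lt 0 q MB) (rem_bO M yO).
apply: (asym_eq (u := fun s =>
  (h s - \sum_(2 <= j < M.+2) powR_coef L p j * y s ^+ j) +
  \sum_(2 <= j < M.+2) powR_coef L p j * y s ^+ j)) => [s|]; first by rewrite subrK.
apply: asymD; first exact: asym_O.
apply: asym_sum => -[|[|j]] // _; exact: powers_expand.
Qed.

Lemma step_down l B : (forall k (mu : R), B k.+1 mu -> B k mu) ->
  forall k (mu : R), step l B k.+1 mu -> step l B k mu.
Proof.
move=> Bd k mu [/Bd|[-> [//|Bk]]]; first by left.
right; split => //; case: k Bk => [|k] Bk; first by left.
by right; exact: Bd.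
Qed.

Lemma step_neg l B : l < 0 -> (forall k (mu : R), B k mu -> mu < 0) ->
  forall k (mu : R), step l B k mu -> mu < 0.
Proof. by move=> ln Bn k mu [/Bn|[->]]. Qed.

Lemma solve4 B q be : (forall k (mu : R), B k.+1 mu -> B k mu) ->
  (forall k (mu : R), B k mu -> mu < 0) -> be < 0 ->
  l1 != be -> l2 != be -> l3 != be -> asym B q be h ->
  asym (step l3 (step l2 (step l1 B))) q be y.
Proof.
move=> Bd Bn be0 b1 b2 b3 hB.
have s1 := asym_solve Bd b1 hB d3.
have s2 := asym_solve (step_down Bd) b2 s1 d2.
have s3 := asym_solve (step_down (step_down Bd)) b3 s2 d1.
have l20 : l2 < 0 by exact: le_lt_trans l23 l30.
have l10 : l1 < 0 by exact: lt_trans l12 l20.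
have [s0 ys0] := y_small ltr01.
apply: (asym_solve_bounded _ _ be0 l40 s3 d0 ys0).
- by do 3 apply: step_down.
- by do 3 apply: step_neg => //.
Qed.

(** The forcing modes start at [2 l3], so [l3] does not resonate, and [l1] lies below both the
    forcing modes and the error. Only [l2] can coincide with a multiple, which yields at most one
    factor [s]. *)
Lemma solve_multiples d q be : (2 <= d)%N -> l2 < l3 ->
  (forall j, (2 <= j < d)%N -> l1 < j%:R * l3) ->
  l1 < be -> be < 0 -> l2 != be -> l3 != be ->
  asym (multiples l3 2 d) q be h ->
  asym (fun k mu => multiples l3 1 d k mu \/ mu = l2 /\
    (k = 0%N \/ k = 1%N /\ exists2 j, (2 <= j < d)%N & l2 = j%:R * l3)) q be y.
Proof.
move=> d2' l23' l1j l1b be0 b2 b3 hB.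
have l13 : l1 < l3 by exact: lt_trans l23'.
have b1 : l1 != be by rewrite lt_eqF.
have dn k (mu : R) : multiples l3 2 d k.+1 mu -> multiples l3 2 d k mu by case.
have ng k (mu : R) : multiples l3 2 d k mu -> mu < 0.
  move=> [_ [j /andP[j2 _] ->]]; apply: lt_trans l30.
  by have := natl_lt j2; rewrite mul1r.
have n3 k : ~ multiples l3 2 d k l3.
  by move=> [_ [j /andP[j2 _] e]]; have := natl_lt j2; rewrite mul1r -e ltxx.
have n1 k : ~ multiples l3 2 d k l1.
  by move=> [_ [j jd e]]; have := l1j _ jd; rewrite -e ltxx.
apply: asym_drop (solve4 dn ng be0 b1 b2 b3 hB) => k mu.
case=> [[[Bk|[-> _]]|[-> [->|[Bk|[e _]]]]]|[-> [->|[[Bk|[e _]]|[e _]]]]].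
- left; left; case: Bk => -> [j /andP[j2 jd] ->]; split => //; exists j => //.
  by rewrite jd (ltnW j2).
- by right; left.
- by left; right; split => //; left.
- left; right; split => //; case: Bk; case: k => [|[|//]] /= _ jd; first by left.
  by right.
- by move: l12; rewrite e ltxx.
- by left; left; split => //; exists 1%N; rewrite ?mul1r// d2'.
- by have := n3 _ Bk.
- by move: l13; rewrite e ltxx.
- by move: l23'; rewrite e ltxx.
Qed.

(** Each round lowers the error exponent by [|l3|], from [2 l3 + d] to [k.+1 l3 + d]. The offset [d]
    keeps it off [l2], which stays hidden in the error until the last round. *)
Lemma multiples_to_resonance (k : nat) (d : R) : (1 <= k)%N -> l2 < l3 ->
  l2 <= k%:R * l3 -> 0 < d -> k.+1%:R * l3 + d < l2 -> d < - l3 ->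
  asym (fun j mu => multiples l3 1 k.+1 j mu \/
      mu = l2 /\ (j = 0%N \/ j = 1%N /\ l2 = k%:R * l3)) 0 (k.+1%:R * l3 + d) y.
Proof.
move=> k1 l23' lk dpos kd dl.
have l1S : l1 < k.+1%:R * l3.
  by rewrite -natr1 mulrDl mul1r; move: l14 l40 lk; lra.
have main i : (2 <= i <= k.+1)%N ->
    asym (fun j mu => multiples l3 1 i j mu \/
      mu = l2 /\ (j = 0%N \/ j = 1%N /\ l2 = k%:R * l3)) 0 (i%:R * l3 + d) y.
  elim: i => [//|i IH] /andP[i2 ik].
  have il : k.+1%:R * l3 <= i.+1%:R * l3 by exact: natl_le.
  have i2' : i.+1%:R * l3 <= 2%:R * l3 by exact: natl_le.
  suff hB : asym (multiples l3 2 i.+1) 0 (i.+1%:R * l3 + d) h.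
    apply: asym_drop (solve_multiples i2 l23' _ _ _ _ _ hB).
    - move=> j mu [|[-> [->|[-> [j' /andP[j2 ji] e]]]]]; left; [by left|by right; split; [|left]|].
      right; split => //; right; split => //; apply/le_anti; rewrite lk e natl_le//.
      by rewrite -ltnS (leq_trans ji ik).
    - move=> j /andP[j2 ji]; apply: lt_le_trans l1S _; apply: natl_le.
      exact: ltnW (leq_trans ji ik).
    - by move: l1S il dpos; lra.
    - by move: i2' dl l30; lra.
    - have [ki|ik'] := leqP i.+1 k.
        have : k%:R * l3 <= i.+1%:R * l3 by exact: natl_le.
        by move=> ?; rewrite lt_eqF//; move: lk dpos; lra.
      have -> : i = k by apply/eqP; rewrite eqn_leq; apply/andP; split; [exact: ik|exact: ik'].
      by rewrite gt_eqF.
    - by rewrite gt_eqF//; move: i2' dl; lra.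
  (* First round: the remainder is quadratic, so the rate [l3 + d / 2] of [y] becomes [2 l3 + d]. *)
  move: i2; rewrite leq_eqVlt => /predU1P[[<-]|i2].
    apply/asym_O; have := rem_bO 0 (decay_bO (ltac:(lra) : 0 < d / 2)).
    have -> : 2%:R * (l3 + d / 2) = 2%:R * l3 + d by field.
    by apply: bO_eq => s; rewrite big_geq// subr0.
  have {}IH := IH (introT andP (conj i2 (ltnW ik))).
  have ki : k%:R * l3 <= i%:R * l3 by apply: natl_le; exact: ik.
  have -> : i.+1%:R * l3 + d = i%:R * l3 + d + l3 by rewrite -natr1; ring.
  apply: rem_expand; [|lra|].
  - apply: asym_drop IH => j mu [|[-> _]]; first by left.
    by right; apply: negl_lt; move: lk dpos; lra.
  - have : i%:R * l3 <= 2%:R * l3 by exact: natl_le.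
    by move: dl; lra.
by apply: main; rewrite leqnn ltnS k1.
Qed.

Lemma small_gap (k : nat) : k.+1%:R * l3 < l2 ->
  exists d : R, [/\ 0 < d, k.+1%:R * l3 + d < l2 & d < - l3].
Proof.
move=> kl; exists (Num.min (l2 - k.+1%:R * l3) (- l3) / 2).
have m0 : 0 < Num.min (l2 - k.+1%:R * l3) (- l3).
  by rewrite lt_min; move: kl l30 => *; apply/andP; split; lra.
have : Num.min (l2 - k.+1%:R * l3) (- l3) <= l2 - k.+1%:R * l3 by rewrite ge_min lexx.
have : Num.min (l2 - k.+1%:R * l3) (- l3) <= - l3 by rewrite ge_min lexx orbT.
by split; lra.
Qed.

(** The [l2] mode is put into an error of exactly its own size; one more round then gives the error
    [l2 + l3]. Since [l2 < k l3], the multiple [k.+1 l3] is still above it and must be kept. *)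
Lemma expansion_nonresonant (k : nat) : (1 <= k)%N -> l2 < k%:R * l3 ->
  k.+1%:R * l3 < l2 ->
  exists (a : nat -> R) (b : R),
    bO (fun s => y s - b * ep 0 l2 s - \sum_(1 <= j < k.+2) a j * ep 0 (j%:R * l3) s)
      0 (l2 + l3).
Proof.
move=> k1 lk kl; have l23' : l2 < l3.
  by apply: lt_le_trans lk _; have := natl_le k1; rewrite mul1r.
have [d [dpos kd dl]] := small_gap kl.
have T := multiples_to_resonance k1 l23' (ltW lk) dpos kd dl.
have yB : asym (multiples l3 1 k.+1) 0 l2 y.
  apply: asym_weaken T; last exact: negl_lt.
  move=> j mu [|[-> [->|[_ e]]]]; [by left|by right; right|].
  by move: lk; rewrite -e ltxx.
have hB := rem_expand yB (ltW kl) l23'.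
have l1S j : (2 <= j < k.+2)%N -> l1 < j%:R * l3.
  move=> /andP[j2 jk]; have : k.+1%:R * l3 <= j%:R * l3 by exact: natl_le.
  by rewrite -[in X in X <= _]natr1 mulrDl mul1r; move: l14 l40 lk; lra.
have be1 : l1 < l2 + l3 by move: l14 l40; lra.
have be2 : l2 + l3 < l2 by move: l30; lra.
have be3 : l2 + l3 < l3 by move: l23' l30; lra.
have yB2 := solve_multiples (isT : 2 <= k.+2)%N l23' l1S be1 (lt_trans be3 l30)
  (negbT (gt_eqF be2)) (negbT (gt_eqF be3)) hB.
have [|b yb] := @asym_extract _ _ (multiples l3 1 k.+2) 0 (l2 + l3) 0 l2 y _ yB2.
  move=> j mu [|[-> [->|[_ [j' /andP[j2 jk] e]]]]]; [by left|by right|].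
  have [jk'|kj] := leqP j' k.
    by have := natl_le jk'; rewrite -e; move: lk; lra.
  by have := natl_le kj; rewrite -e; move: kl; lra.
have [a ya] := asym_extract_sum yb.
by exists a, b.
Qed.

(** Both [ep 0 l2] and [ep 1 l2] go into an error of degree 1, whence the logarithm in the final
    error. *)
Lemma expansion_resonant (k : nat) : (2 <= k)%N -> l2 = k%:R * l3 ->
  exists (a : nat -> R) (b : R),
    bO (fun s => y s - b * ep 1 l2 s - \sum_(1 <= j < k.+1) a j * ep 0 (j%:R * l3) s)
      1 (l2 + l3).
Proof.
move=> k2 lk; have k1 : (1 <= k)%N by exact: ltnW.
have l23' : l2 < l3 by have := natl_lt k2; rewrite mul1r -lk.
have kl : k.+1%:R * l3 < l2 by rewrite lk; exact: natl_lt.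
have lk' : l2 <= k%:R * l3 by rewrite -lk.
have [d [dpos kd dl]] := small_gap kl.
have T := multiples_to_resonance k1 l23' lk' dpos kd dl.
have yB : asym (multiples l3 1 k) 1 l2 y.
  apply: asym_weaken T; last exact: negl_lt.
  move=> j mu [[-> [i /andP[i1 ik] ->]]|[-> [->|[-> _]]]]; [|by right; right|by right; right].
  move: ik; rewrite ltnS leq_eqVlt => /predU1P[->|ik]; first by right; right.
  by left; split => //; exists i => //; rewrite i1.
have kl' : k%:R * l3 <= l2 by rewrite lk.
have hB := rem_expand yB kl' l23'.
have be1 : l1 < l2 + l3 by move: l14 l40; lra.
have be2 : l2 + l3 < l2 by move: l30; lra.
have be3 : l2 + l3 < l3 by move: l23' l30; lra.
have l1S j : (2 <= j < k.+1)%N -> l1 < j%:R * l3.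
  by move=> /andP[j2 jk]; apply: lt_le_trans l12 _; rewrite lk natl_le.
have yB2 := solve_multiples (k1 : 2 <= k.+1)%N l23' l1S be1 (lt_trans be3 l30)
  (negbT (gt_eqF be2)) (negbT (gt_eqF be3)) hB.
have [|b yb] := @asym_extract _ _ (multiples l3 1 k.+1) 1 (l2 + l3) 1 l2 y _ yB2.
  move=> j mu [|[-> [->|[-> _]]]]; [by left| |by right].
  by left; split => //; exists k => //; rewrite k1 ltnSn.
have [a ya] := asym_extract_sum yb.
by exists a, b.
Qed.

(** The double root gives [y] the modes [ep 0 l3] and [ep 1 l3], so its square has degree 2 at
    [2 l3]. No root equals [2 l3], so the degree is not raised; the degrees 0 and 1 there belong to
    the error. *)
Lemma expansion_double : l2 = l3 ->
  exists a1 b1 b2 : R,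
    bO (fun s => y s - b1 * ep 1 l3 s - a1 * ep 0 l3 s - b2 * ep 2 (2 * l3) s) 1 (2 * l3).
Proof.
(* Any positive [d < - l3 / 3] would do: the products with the error and the cubic remainder then
   fall below [2 l3]. *)
move=> e23; pose d := - l3 / 8.
have dpos : 0 < d by rewrite /d; move: l30; lra.
have l1b : l1 < 2 * l3 by move: l14 l40; rewrite e23; lra.
pose be := 2 * l3 + 2 * d.
have h0 : asym (fun _ _ => False) 0 be h.
  apply/asym_O; have := rem_bO 0 (decay_bO dpos).
  have -> : 2%:R * (l3 + d) = be by rewrite /be; ring.
  by apply: bO_eq => s; rewrite big_geq// subr0.
pose B1 k (mu : R) := (k <= 1)%N /\ mu = l3.
have yB : asym B1 0 be y.
  have bel : be < l3 by rewrite /be /d; move: l30; lra.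
  have lbe : l1 < be by rewrite /be; move: dpos l1b; lra.
  have n1 : l1 != be by rewrite lt_eqF.
  have n3 : l3 != be by rewrite gt_eqF.
  have n2 : l2 != be by rewrite e23.
  have := @solve4 (fun _ _ => False) 0 be (fun _ _ F => F)
    (fun _ _ F => False_ind _ F) (lt_trans bel l30) n1 n2 n3 h0.
  rewrite e23.
  apply: asym_drop => k mu.
  case=> [[[//|[-> _]]|[-> [->|[//|[e _]]]]]|[-> [->|[[//|[e _]]|[_ kk]]]]].
  - by right; left.
  - by left.
  - by move: l12; rewrite e23 e ltxx.
  - by left.
  - by move: l12; rewrite e23 e ltxx.
  - left; split => //; case: kk => [|[//|[e _]]]; first by case: k => [|[|]].
    by move: l12; rewrite e23 e ltxx.
pose B2 k (mu : R) := (k <= 2)%N /\ mu = 2 * l3.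
have y2B : asym B2 1 (2 * l3) (fun s => y s * y s).
  have e2 : l3 + l3 = 2 * l3 by ring.
  have n1 k : negl k (l3 + be) 1 (2 * l3).
    by apply: negl_lt; rewrite /be /d; move: l30; lra.
  apply: (asymM _ _ _ _ yB yB).
  - move=> k mu k' mu' [kk ->] [kk' ->]; left; rewrite /B2 e2; split => //.
    exact: leq_add kk kk'.
  - by move=> k mu [kk ->].
  - by move=> k mu [kk ->]; rewrite addrC.
  - by apply: negl_lt; rewrite /be /d; move: l30; lra.
have hB : asym B2 1 (2 * l3) h.
  have r := rem_bO 1 (decay_bO dpos).
  have n3 : negl 0 (3%:R * (l3 + d)) 1 (2 * l3).
    by apply: negl_lt; rewrite /d; move: l30; lra.
  apply: asym_eq (asymD (asym_O B2 (bO_weaken n3 r)) (asymZ (powR_coef L p 2) y2B)) => s.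
  by rewrite big_nat1 expr2; ring.
have b1 : l1 != 2 * l3 by rewrite lt_eqF.
have b2 : l3 != 2 * l3 by rewrite gt_eqF//; move: l30; lra.
have B2d k (mu : R) : B2 k.+1 mu -> B2 k mu by move=> [kk ->]; split => //; exact: ltnW.
have B2n k (mu : R) : B2 k mu -> mu < 0 by move=> [_ ->]; move: l30; lra.
have l20 : 2 * l3 < 0 by move: l30; lra.
have b2' : l2 != 2 * l3 by rewrite e23.
have yB2 := solve4 B2d B2n l20 b1 b2' b2 hB; rewrite e23 in yB2.
have nl : ~ l3 = 2 * l3 by move/eqP: b2.
have nl1 : ~ l1 = 2 * l3 by move/eqP: b1.
have nl13 : ~ l3 = l1 by move=> e; move: l12; rewrite e23 e ltxx.
pose B3 k (mu : R) := [\/ k = 0%N /\ mu = l3, k = 1%N /\ mu = l3 | k = 2%N /\ mu = 2 * l3].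
have {}yB2 : asym B3 1 (2 * l3) y.
  apply: asym_drop yB2 => k mu.
  case=> [[[[k2 ->]|[-> _]]|[-> [->|[[_ //]|[//]]]]]|[-> [->|[[[_ //]|[//]]|[_ kk]]]]].
  - case: k k2 => [|[|[|//]]] _; [by right; right|by right; right|].
    by left; constructor 3.
  - by right; left.
  - by left; constructor 1.
  - by left; constructor 1.
  - left; case: kk => [|[[_ //]|[//]]].
    by case: k => [|[|//]] _; [constructor 1|constructor 2].
have [|b1' yb1] := @asym_extract _ _
  (fun k mu => k = 0%N /\ mu = l3 \/ k = 2%N /\ mu = 2 * l3) 1 (2 * l3) 1 l3 y _ yB2.
  by move=> k mu [[-> ->]|[-> ->]|[-> ->]]; [left; left|right|left; right].
have [|a1 ya1] := @asym_extract _ _ (fun k mu => k = 2%N /\ mu = 2 * l3) 1 (2 * l3) 0 l3 _ _ yb1.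
  by move=> k mu [[-> ->]|[-> ->]]; [right|left].
have [|c2 yb2] := @asym_extract _ _ (fun _ _ => False) 1 (2 * l3) 2 (2 * l3) _ _ ya1.
  by move=> k mu [-> ->]; right.
by exists a1, b1', c2; apply: asym_nil yb2 => k mu [].
Qed.

End Expansion.

(** * Back to the variable [r = exp s] *)

Section Landau.
Context {R : realType}.

Lemma ep_ln k (mu r : R) : 0 < r -> ep k mu (ln r) = ln r ^+ k * r `^ mu.
Proof. by move=> r0; rewrite /ep /powR gt_eqF. Qed.

Lemma bO_landau (A B g v : R -> R) q be : bO v q be ->
  (forall r, 0 < r -> A r - B r = v (ln r)) ->
  (forall r, 0 < r -> ep q be (ln r) = g r) ->
  forall r, A r = B r +O_(r \near pinfty_nbhs R) (g r).
Proof.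
move=> [C [s0 [C0 s01 hC]]] vE gE.
suff H : exists2 k, k > 0 & \forall x \near pinfty_nbhs R, `|(A - B) x| <= k * `|g x|.
  have {}H : A = B +O_ (pinfty_nbhs R) g.
    by apply/eqaddOP; apply/bigO_exP.
  by move=> r; exact: (congr1 (fun F => F r) H).
exists (C + 1); first by rewrite /=; lra.
exists (expR s0); split; first exact: num_real.
move=> r /ltW rs /=.
have r0 : 0 < r by apply: lt_le_trans rs; exact: expR_gt0.
have sr : s0 <= ln r by rewrite -[s0]expRK ler_ln// posrE expR_gt0.
have := hC _ sr; rewrite gE// -vE// => h.
by apply: le_trans h _; have := ler_norm (g r); have := normr_ge0 (g r); nra.
Qed.

End Landau.

Theorem theorem1p1 (R : realType) (n : nat) (hn : (13 <= n)%N) :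
  exists (N : nat) (pk : nat -> R),
    [/\ (1 <= N)%N,
        (pk 1%N)%:E = critical_power n,
        (forall k : nat, (1 <= k < N)%N -> pk k < pk k.+1) &
    forall p : R, (critical_power n <= p%:E)%E ->
    exists l1 l2 l3 l4 : R,
    [/\ ordered_eigenvalues n p l1 l2 l3 l4,
        (forall k : nat, (1 <= k <= N)%N ->
           l2 <= k%:R * l3 <-> pk k <= p),
        (forall k : nat, (1 <= k <= N)%N ->
           pk k < p -> ((k < N)%N -> p < pk k.+1) ->
           forall (phi : 'rV[R]_n -> R) (f : R -> R),
             positive_radial_solution p phi f ->
           exists (a : nat -> R) (b1 : R),
             forall r : R, r `^ (4 / (p - 1)) * f r =
               (a 0%N + \sum_(1 <= j < k.+1) a j * r `^ (j%:R * l3)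
                + b1 * r `^ l2 + a k.+1 * r `^ (k.+1%:R * l3))
               +O_(r \near pinfty_nbhs R) (r `^ (l2 + l3))),
        (forall k : nat, (2 <= k <= N)%N -> p = pk k ->
           k%:R * l3 = l2 /\
           forall (phi : 'rV[R]_n -> R) (f : R -> R),
             positive_radial_solution p phi f ->
           exists (a : nat -> R) (b1 : R),
             forall r : R, r `^ (4 / (p - 1)) * f r =
               (a 0%N + \sum_(1 <= j < k) a j * r `^ (j%:R * l3)
                + r `^ (k%:R * l3) * (b1 * ln r + a k))
               +O_(r \near pinfty_nbhs R) (r `^ (l2 + l3) * ln r)) &
        (p%:E = critical_power n ->
           l2 = l3 /\
           forall (phi : 'rV[R]_n -> R) (f : R -> R),
             positive_radial_solution p phi f ->
           exists a0 a1 b1 b2 : R,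
             forall r : R, r `^ (4 / (p - 1)) * f r =
               (a0 + r `^ l3 * (b1 * ln r + a1)
                + b2 * r `^ (2 * l3) * ln r ^+ 2)
               +O_(r \near pinfty_nbhs R) (r `^ (2 * l3) * ln r))]].
Proof.

Proof.
have [N [pk [N1 pk1 pkS params]]] := parameters (R := R) hn.
exists N, pk; split => // p pc.
have [p1 dp [l1 [l2 [l3 [l4 [oe [l14 lN fac] lle llt]]]]]] := params p pc.
exists l1, l2, l3, l4.
have [_ [l12 l23 l30 l40]] := oe.
have N11 : (1 <= 1 <= N)%N by rewrite N1.
have sol (phi : 'rV[R]_n -> R) f : positive_radial_solution p phi f ->
  exists (L : R) (y y1 y2 y3 : R -> R),
  [/\ 0 < L /\ (forall r, 0 < r -> r `^ (4 / (p - 1)) * f r = L + y (ln r)),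
      derives y (fun s => l4 * y s + y1 s) /\ derives y1 (fun s => l3 * y1 s + y2 s),
      derives y2 (fun s => l2 * y2 s + y3 s) /\
      derives y3 (fun s => l1 * y3 s + powR_rem L p (y s)) &
      forall d, 0 < d -> exists C s0, forall s, s0 <= s -> `|y s| <= C * expR ((l3 + d) * s)].
  move=> /(emden_fowler hn p1)[w [jw bw wE w0 ode]].
  have src : p * quartic (half_dim n) (drift n p ^+ 2) =
      shifted_source (half_dim n) (drift n p) :> R by rewrite -Q4_drift source_drift.
  have [L [y [y1 [y2 [y3 [[L0 wy] d01 d23 dec]]]]]] :=
    approach_singular p1 dp src jw bw w0 ode l12 l23 l30 l40 fac.
  exists L, y, y1, y2, y3; split => //; split => // r r0.
  by rewrite -wy wE lnK// /powR gt_eqF.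
split => //.
- by move=> k kN; rewrite lle.
- move=> k kN pkp ppk phi f /sol[L [y [y1 [y2 [y3 [[L0 wy] [d0 d1] [d2 d3] dec]]]]]].
  have k1 : (1 <= k)%N by case/andP: kN.
  have lk : l2 < k%:R * l3 by rewrite llt.
  (* For [k < N] this is [p < pk k.+1]; for [k = N] it comes from the maximality of [N]. *)
  have kl : k.+1%:R * l3 < l2.
    have [kN'|Nk] := ltnP k N; first by rewrite ltNge lle ?kN'// -ltNge ppk.
    by have -> : k = N by apply/anti_leq; rewrite Nk andbT; case/andP: kN.
  have [a [b hb]] := expansion_nonresonant l12 l23 l30 l40 l14 L0 d0 d1 d2 d3 dec k1 lk kl.
  (* The constant term is the limit [L]; the expansion of [y] supplies the coefficients from index 1
     on. *)
  exists (fun j => if j is 0 then L else a j)%N, b.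
  apply: (bO_landau hb) => r r0; last by rewrite ep_ln// expr0 mul1r.
  rewrite wy// !ep_ln// expr0 mul1r [in RHS]big_nat_recr//= ep_ln// expr0 mul1r.
  have -> : \sum_(1 <= j < k.+1) a j * ep 0 (j%:R * l3) (ln r) =
      \sum_(1 <= j < k.+1) (if j is 0 then L else a j)%N * r `^ (j%:R * l3).
    by apply: eq_big_nat => -[//|j] _; rewrite ep_ln// expr0 mul1r.
  by ring.
- move=> k kN ppk; have /andP[k2 kN'] := kN.
  have kN1 : (1 <= k <= N)%N by rewrite kN' ltnW.
  have lk : l2 = k%:R * l3.
    by apply/le_anti; rewrite lle// ppk lexx /= leNgt llt// ppk ltxx.
  split => // phi f /sol[L [y [y1 [y2 [y3 [[L0 wy] [d0 d1] [d2 d3] dec]]]]]].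
  have [a [b hb]] := expansion_resonant l12 l23 l30 l40 l14 L0 d0 d1 d2 d3 dec k2 lk.
  exists (fun j => if j is 0 then L else a j)%N, b.
  apply: (bO_landau hb) => r r0; last by rewrite ep_ln// expr1 mulrC.
  have k1 : (1 <= k)%N by exact: ltnW.
  rewrite wy// ep_ln// expr1 [in RHS]big_nat_recr//= ep_ln// expr0 mul1r -lk.
  have -> : \sum_(1 <= j < k) a j * ep 0 (j%:R * l3) (ln r) =
      \sum_(1 <= j < k) (if j is 0 then L else a j)%N * r `^ (j%:R * l3).
    by apply: eq_big_nat => -[//|j] _; rewrite ep_ln// expr0 mul1r.
  by case: k {kN ppk kN' kN1 lk hb} k1 k2 => // k _ _; ring.
- rewrite -pk1 => -[ppk].
  have l23' : l2 = l3.
    by apply/le_anti; rewrite l23 -[l3]mul1r leNgt (llt 1%N)// ppk ltxx.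
  split => // phi f /sol[L [y [y1 [y2 [y3 [[L0 wy] [d0 d1] [d2 d3] dec]]]]]].
  have [a1 [b1 [b2 hb]]] := expansion_double l12 l23 l30 l40 l14 L0 d0 d1 d2 d3 dec l23'.
  exists L, a1, b1, b2.
  apply: (bO_landau hb) => r r0; last by rewrite ep_ln// expr1 mulrC.
  by rewrite wy// !ep_ln// expr0 expr1 mul1r; ring.
Qed.
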